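(* Let $p>1$, $N\ge2m-1$, and let $\mathcal I\subseteq\{1,\dots,N\}$ be a nonempty index set. Then there exists a set $S_A\subseteq\mathbb R^{m\times N}$ whose complement has Lebesgue measure zero such that for each fixed $A\in S_A$, the unique optimal solution $x^*$ of $\min_{x\in\mathbb R^N}\|x\|_p$ subject to $Ax=y$ satisfies $|\mathrm{supp}(x^* )|=N$ for almost all $y\in R(A_{\bullet\mathcal I})$ (with respect to Lebesgue measure on the subspace $R(A_{\bullet\mathcal I})$).
   Context: $\|x\|_p:=(\sum_i|x_i|^p)^{1/p}$; $\mathrm{supp}(x)=\{i:x_i\ne0\}$. For an index set $\mathcal I$, $A_{\bullet\mathcal I}$ is the submatrix of $A$ formed by the columns indexed by $\mathcal I$, and $R(\cdot)$ denotes the range. *)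

(* Defs.v *)
From Stdlib Require Import Reals List.
Import ListNotations.
Open Scope R_scope.

(* Vectors in R^n are functions nat -> R (only coordinates < n matter);
   m x N matrices are functions nat -> nat -> R (entries A i j, i<m, j<N). *)

Definition rsum (f : nat -> R) (n : nat) : R :=
  fold_right Rplus 0 (map f (seq 0 n)).
Definition rprod (f : nat -> R) (n : nat) : R :=
  fold_right Rmult 1 (map f (seq 0 n)).

(* a^b for a >= 0, with the convention 0^b = 0 (b > 0) *)
Definition rpow (a b : R) : R :=
  if Req_EM_T a 0 then 0 else Rpower a b.

Definition pnorm (p : R) (N : nat) (x : nat -> R) : R :=
  rpow (rsum (fun i => rpow (Rabs (x i)) p) N) (1 / p).

Definition mv (A : nat -> nat -> R) (N : nat) (x : nat -> R) : nat -> R :=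
  fun i => rsum (fun j => A i j * x j) N.

Definition box_vol (n : nat) (a b : nat -> R) : R :=
  rprod (fun i => b i - a i) n.

Definition nullset (n : nat) (E : (nat -> R) -> Prop) : Prop :=
  forall eps : R, 0 < eps ->
  exists a b : nat -> nat -> R,
    (forall k i, a k i <= b k i) /\
    (forall x, E x -> exists k, forall i, (i < n)%nat -> a k i <= x i <= b k i) /\
    (forall K, rsum (fun k => box_vol n (a k) (b k)) K <= eps).

Definition matnull (m N : nat) (E : (nat -> nat -> R) -> Prop) : Prop :=
  nullset (m * N) (fun v => E (fun i j => v (i * N + j)%nat)).

(* "P holds for almost all y in the linear subspace V of R^m" with respect to
   Lebesgue measure on V: V is the injective image of R^k under some m x k
   matrix B, and the set of parameters z in R^k for which P (B z) fails is a
   Lebesgue null set of R^k. *)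
Definition ae_subspace (m : nat) (V P : (nat -> R) -> Prop) : Prop :=
  exists (k : nat) (B : nat -> nat -> R),
    (forall z, (forall i, (i < m)%nat -> mv B k z i = 0) ->
               forall j, (j < k)%nat -> z j = 0) /\
    (forall y, V y <-> exists z, forall i, (i < m)%nat -> y i = mv B k z i) /\
    nullset k (fun z => ~ P (mv B k z)).

Definition colrange (m N : nat) (A : nat -> nat -> R) (I : nat -> Prop)
    (y : nat -> R) : Prop :=
  exists x : nat -> R,
    (forall j, (j < N)%nat -> ~ I j -> x j = 0) /\
    (forall i, (i < m)%nat -> y i = mv A N x i).

Definition lp_opt (p : R) (m N : nat) (A : nat -> nat -> R) (y x : nat -> R)
  : Prop :=
  (forall i, (i < m)%nat -> mv A N x i = y i) /\
  (forall z, (forall i, (i < m)%nat -> mv A N z i = y i) ->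
             pnorm p N x <= pnorm p N z).

(* Main.v *)
Require Import Defs.
From Stdlib Require Import Reals List.
From Stdlib Require Import Lia Lra ZArith Classical IndefiniteDescription Cantor.
From Stdlib Require FinFun.
Import ListNotations.
Open Scope R_scope.

(** A vector [x] is optimal iff [A x = y] and [sgn(x_j) |x_j|^(p-1) = a_j . nu]
    for some multiplier [nu], where [a_j] is the [j]-th column of [A]; strict
    monotonicity of [t |-> sgn(t) |t|^(p-1)] makes [x] unique.  Take a basis
    [A_s] of the column space of [A_I] and write [y = A_s z].
    - If [j] belongs to the basis, two points on a [z_j]-line with [x_j = 0] have
      the same solution by monotonicity, hence coincide.
    - If [j] is not in the basis and [x_j = 0], then [x] and [nu] do not depend on
      [a_j] as soon as the other columns span [R^m], and [a_j . nu = 0] determines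
      the entry [A_ij] whenever [nu_i <> 0].
    So the exceptional sets are countable unions of compact sets meeting every
    line parallel to some axis in at most one point; by compactness such a set is
    met by a vanishing proportion of the cells of a fine cubic grid.  In the
    second case the null set lives in the space of pairs [(A, z)], and a Fubini
    argument, counting grid cells, passes to almost every [A]. *)

(** * Null sets and grids *)

(** Slicing arbitrary null sets would need an integration theory. It is done here for a finitary
    notion instead, covering by few cells of one uniform grid, where Fubini becomes a double count;
    null sets reappear only through countable unions. Thinness along an axis becomes uniform by
    compactness, so every open condition (a block is invertible, a multiplier entry is nonzero, a
    vector is bounded) is replaced by a closed quantitative form with a natural number [M], and the
    union over [M] is taken afterwards. The solution and its multiplier are never studied as
    functions of the data: they are carried as extra coordinates of a closed set and projected away,
    so that uniqueness along a line suffices and no smooth dependence is needed. The basis depends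
    on [A], whereas the good matrices must be fixed beforehand; since index lists are countable, all
    of them are treated at once. If the multiplier vanishes then so does [x], basis coordinates
    included, and the first case of the overview applies. *)

Lemma rsum_S (f : nat -> R) n : rsum f (S n) = rsum f n + f n.
Proof.
  unfold rsum. rewrite seq_S, map_app, fold_right_app. simpl.
  generalize (map f (seq 0 n)). intros l.
  induction l; simpl; [lra | rewrite IHl; lra].
Qed.

Lemma rprod_S (f : nat -> R) n : rprod f (S n) = rprod f n * f n.
Proof.
  unfold rprod. rewrite seq_S, map_app, fold_right_app. simpl.
  generalize (map f (seq 0 n)). intros l.
  induction l; simpl; [lra | rewrite IHl; lra].
Qed.

Lemma rsum_ext (f g : nat -> R) n :
  (forall i, (i < n)%nat -> f i = g i) -> rsum f n = rsum g n.
Proof.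
  induction n; intros H; [reflexivity |].
  rewrite !rsum_S, IHn, (H n); auto with arith.
Qed.

Lemma rsum_le (f g : nat -> R) n :
  (forall i, (i < n)%nat -> f i <= g i) -> rsum f n <= rsum g n.
Proof.
  induction n; intros H; [apply Rle_refl |].
  rewrite !rsum_S. apply Rplus_le_compat; auto with arith.
Qed.

Lemma rsum_const c n : rsum (fun _ => c) n = INR n * c.
Proof.
  induction n; [simpl; unfold rsum; simpl; lra |].
  rewrite rsum_S, IHn, S_INR. lra.
Qed.

Lemma rsum_plus (f g : nat -> R) n :
  rsum (fun i => f i + g i) n = rsum f n + rsum g n.
Proof.
  induction n; [unfold rsum; simpl; lra |]. rewrite !rsum_S, IHn. lra.
Qed.

Lemma rsum_scal c (f : nat -> R) n : rsum (fun i => c * f i) n = c * rsum f n.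
Proof.
  induction n; [unfold rsum; simpl; lra |]. rewrite !rsum_S, IHn. lra.
Qed.

Lemma rsum_minus (f g : nat -> R) n :
  rsum (fun i => f i - g i) n = rsum f n - rsum g n.
Proof.
  induction n; [unfold rsum; simpl; lra |]. rewrite !rsum_S, IHn. lra.
Qed.

Lemma rsum_swap (f : nat -> nat -> R) n m :
  rsum (fun i => rsum (fun j => f i j) m) n = rsum (fun j => rsum (fun i => f i j) n) m.
Proof.
  induction n.
  - induction m; [reflexivity |]. rewrite rsum_S, <- IHm. unfold rsum. simpl. lra.
  - rewrite rsum_S, IHn, <- rsum_plus. apply rsum_ext. intros. rewrite rsum_S. reflexivity.
Qed.

Lemma rsum_nonneg (f : nat -> R) n :
  (forall i, (i < n)%nat -> 0 <= f i) -> 0 <= rsum f n.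
Proof.
  intros H. rewrite <- (Rmult_0_r (INR n)), <- rsum_const. now apply rsum_le.
Qed.

Lemma rsum_zero (f : nat -> R) n :
  (forall i, (i < n)%nat -> f i = 0) -> rsum f n = 0.
Proof.
  intros H. rewrite (rsum_ext f (fun _ => 0)) by assumption. rewrite rsum_const. lra.
Qed.

Lemma rsum_single (f : nat -> R) n i :
  (i < n)%nat -> (forall j, (j < n)%nat -> j <> i -> f j = 0) -> rsum f n = f i.
Proof.
  induction n; intros Hi H; [lia |]. rewrite rsum_S.
  destruct (Nat.eq_dec i n) as [-> | Hne].
  - rewrite rsum_zero; [lra |]. intros; apply H; lia.
  - rewrite IHn, (H n) by (try lia; intros; apply H; lia). lra.
Qed.

Lemma rsum_term_le (f : nat -> R) n i :
  (forall j, (j < n)%nat -> 0 <= f j) -> (i < n)%nat -> f i <= rsum f n.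
Proof.
  induction n; intros H Hi; [lia |]. rewrite rsum_S.
  destruct (Nat.eq_dec i n) as [-> | Hne].
  - assert (0 <= rsum f n) by (apply rsum_nonneg; auto with arith). lra.
  - assert (f i <= rsum f n) by (apply IHn; auto with arith; lia).
    assert (0 <= f n) by auto with arith. lra.
Qed.

Lemma rsum_zero_inv (f : nat -> R) n :
  (forall i, (i < n)%nat -> 0 <= f i) -> rsum f n <= 0 ->
  forall i, (i < n)%nat -> f i = 0.
Proof.
  intros H H0 i Hi. pose proof (rsum_term_le f n i H Hi). pose proof (H i Hi). lra.
Qed.

Lemma rprod_nonneg (f : nat -> R) n : (forall i, 0 <= f i) -> 0 <= rprod f n.
Proof.
  intros H. induction n; [unfold rprod; simpl; lra |].
  rewrite rprod_S. apply Rmult_le_pos; auto.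
Qed.

Lemma rprod_const c n : rprod (fun _ => c) n = c ^ n.
Proof.
  induction n; [reflexivity |]. rewrite rprod_S, IHn. simpl. lra.
Qed.

Lemma rprod_ext (f g : nat -> R) n :
  (forall i, (i < n)%nat -> f i = g i) -> rprod f n = rprod g n.
Proof.
  induction n; intros H; [reflexivity |].
  rewrite !rprod_S, IHn, (H n); auto with arith.
Qed.

Definition lsum {T} (f : T -> R) (l : list T) : R := fold_right Rplus 0 (map f l).

Lemma lsum_app {T} (f : T -> R) l l' : lsum f (l ++ l') = lsum f l + lsum f l'.
Proof.
  unfold lsum. induction l; simpl; [lra | rewrite IHl; lra].
Qed.

Lemma lsum_incl {T} (f : T -> R) l l' :
  (forall t, 0 <= f t) -> NoDup l -> incl l l' -> lsum f l <= lsum f l'.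
Proof.
  intros Hf Hl. revert l'. induction Hl as [| a l Ha Hl IH]; intros l' Hi.
  - unfold lsum at 1. simpl. induction l'; unfold lsum; simpl; [lra |].
    pose proof (Hf a). assert (0 <= lsum f l') by (apply IHl'; intros ? []).
    unfold lsum in *. lra.
  - destruct (in_split a l') as [l1 [l2 ->]]; [apply Hi; now left |].
    assert (Hle : lsum f l <= lsum f (l1 ++ l2)).
    { apply IH. intros b Hb. assert (Hb' : In b (l1 ++ a :: l2)) by (apply Hi; now right).
      apply in_app_or in Hb'. apply in_or_app.
      destruct Hb' as [| [-> |]]; auto. contradiction. }
    rewrite lsum_app in *. unfold lsum in *. simpl. lra.
Qed.

Lemma lsum_list_prod (f : nat * nat -> R) l n :
  lsum f (list_prod l (seq 0 n)) = lsum (fun i => rsum (fun j => f (i, j)) n) l.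
Proof.
  induction l; [reflexivity |]. simpl list_prod. rewrite lsum_app, IHl.
  unfold lsum, rsum. simpl. now rewrite map_map.
Qed.

(** * Countable unions of null sets *)

Lemma nullset_subset n (E E' : (nat -> R) -> Prop) :
  (forall x, E x -> E' x) -> nullset n E' -> nullset n E.
Proof.
  intros H H' eps Heps. destruct (H' eps Heps) as (a & b & H1 & H2 & H3).
  exists a, b. auto.
Qed.

Lemma box_vol_nonneg n a b : (forall i, a i <= b i) -> 0 <= box_vol n a b.
Proof.
  intros H. apply rprod_nonneg. intros i. specialize (H i). lra.
Qed.

(** The [k]-th set gets a cover of total volume at most [eps / 2^(k+1)], and Cantor's pairing lists
    the double family of boxes as one sequence. *)
Lemma nullset_union n (E : nat -> (nat -> R) -> Prop) :
  (forall k, nullset n (E k)) -> nullset n (fun x => exists k, E k x).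
Proof.
  intros H eps Heps.
  assert (Hc : forall k, exists ab : (nat -> nat -> R) * (nat -> nat -> R),
    (forall l i, fst ab l i <= snd ab l i) /\
    (forall x, E k x -> exists l, forall i, (i < n)%nat -> fst ab l i <= x i <= snd ab l i) /\
    (forall K, rsum (fun l => box_vol n (fst ab l) (snd ab l)) K <= eps * (/ 2) ^ S k)).
  { intros k. destruct (H k (eps * (/ 2) ^ S k)) as (a & b & Hab).
    - apply Rmult_lt_0_compat; [assumption | apply pow_lt; lra].
    - now exists (a, b). }
  apply functional_choice in Hc. destruct Hc as [ab Hab].
  set (a k := fst (ab (fst (of_nat k))) (snd (of_nat k))).
  set (b k := snd (ab (fst (of_nat k))) (snd (of_nat k))).
  exists a, b. split; [| split].
  - intros k i. apply (Hab (fst (of_nat k))).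
  - intros x [k Hk]. destruct (Hab k) as (_ & H2 & _).
    destruct (H2 x Hk) as [l Hl]. exists (to_nat (k, l)).
    unfold a, b. rewrite cancel_of_to. exact Hl.
  - intros K.
    set (f := fun q : nat * nat => box_vol n (fst (ab (fst q)) (snd q)) (snd (ab (fst q)) (snd q))).
    assert (Heq : rsum (fun k => box_vol n (a k) (b k)) K = lsum f (map of_nat (seq 0 K))).
    { unfold rsum, lsum. now rewrite map_map. }
    rewrite Heq.
    (* A Cantor code is at least the sum of its two components, so the first [K] codes decode into
       the square of side [K]. *)
    apply Rle_trans with (lsum f (list_prod (seq 0 K) (seq 0 K))).
    + apply lsum_incl.
      * intros [i j]. apply box_vol_nonneg. apply (Hab i).
      * apply FinFun.Injective_map_NoDup; [| apply seq_NoDup].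
        intros u v Huv. rewrite <- (cancel_to_of u), <- (cancel_to_of v). now rewrite Huv.
      * intros [i j] Hq. apply in_map_iff in Hq. destruct Hq as [k [Hk Hin]].
        apply in_seq in Hin. pose proof (to_nat_non_decreasing i j) as Hij.
        rewrite <- Hk, cancel_to_of in Hij. apply in_prod; apply in_seq; lia.
    + rewrite lsum_list_prod. change (rsum (fun i => rsum (fun j => f (i, j)) K) K <= eps).
      apply Rle_trans with (rsum (fun i => eps * (/ 2) ^ S i) K).
      * apply rsum_le. intros i _. apply (Hab i).
      * rewrite rsum_scal. rewrite <- (Rmult_1_r eps) at 2.
        apply Rmult_le_compat_l; [lra |].
        assert (Hgeo : rsum (fun i => (/ 2) ^ S i) K = 1 - (/ 2) ^ K).
        { clear. induction K; [unfold rsum; simpl; lra |]. rewrite rsum_S, IHK. simpl. lra. }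
        rewrite Hgeo. assert (0 < (/ 2) ^ K) by (apply pow_lt; lra). lra.
Qed.

(** A box degenerate to a point has volume [0^n], which is [0] only for positive [n]: in dimension 0
    the empty product gives every box volume 1. This is why positive dimensions are tracked
    throughout. *)
Lemma nullset_empty n (E : (nat -> R) -> Prop) :
  (0 < n)%nat -> (forall x, ~ E x) -> nullset n E.
Proof.
  intros Hn HE eps Heps. exists (fun _ _ => 0), (fun _ _ => 0).
  split; [intros; lra | split; [intros x Hx; now destruct (HE x) |]].
  intros K. rewrite rsum_zero; [lra |]. intros k _. unfold box_vol.
  rewrite rprod_const. rewrite Rminus_0_r, pow_i; auto.
Qed.

Lemma nullset_or n (E E' : (nat -> R) -> Prop) :
  nullset n E -> nullset n E' -> nullset n (fun x => E x \/ E' x).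
Proof.
  intros H H'. apply nullset_subset with (fun x => exists k : nat, match k with O => E x | _ => E' x end).
  - intros x [Hx | Hx]; [now exists O | now exists 1%nat].
  - apply (nullset_union n (fun k x => match k with O => E x | _ => E' x end)).
    intros [|k]; assumption.
Qed.

(** Induction on the length of the lists: splitting off the head turns the lists of length [k+1]
    into a countable union, over the head, of lists of length [k]. *)
Lemma nullset_union_list n (E : list nat -> (nat -> R) -> Prop) :
  (forall s, nullset n (E s)) -> nullset n (fun x => exists s, E s x).
Proof.
  intros H. apply nullset_subset with (fun x => exists k s, length s = k /\ E s x).
  - intros x [s Hs]. now exists (length s), s.
  - apply nullset_union. intros k. revert E H. induction k; intros E H.
    + apply nullset_subset with (E nil); [| apply H].
      intros x [[| a s] [Hs Hx]]; [assumption | discriminate].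
    + apply nullset_subset with (fun x => exists a s, length s = k /\ E (a :: s) x).
      * intros x [[| a s] [Hs Hx]]; [discriminate |]. exists a, s. auto.
      * apply nullset_union. intros a. apply (IHk (fun s => E (a :: s))). auto.
Qed.

(** * Uniform grids and Jordan content zero *)

Definition cell (K n : nat) (x : nat -> R) : list Z :=
  map (fun i => Int_part (INR K * x i)) (seq 0 n).

(** Cells have side [1/K], so the cells listed in [L] have total volume at most [eps]. A single mesh
    for the whole cover makes volumes comparable by counting. *)
Definition coverable (n : nat) (eps : R) (E : (nat -> R) -> Prop) : Prop :=
  exists (K : nat) (L : list (list Z)),
    (0 < K)%nat /\ INR (length L) <= eps * INR K ^ n /\
    forall x, E x -> In (cell K n x) L.

Definition content_zero (n : nat) (E : (nat -> R) -> Prop) : Prop :=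
  forall eps, 0 < eps -> coverable n eps E.

Lemma content_zero_nullset n E : (0 < n)%nat -> content_zero n E -> nullset n E.
Proof.
  intros Hn H eps Heps. destruct (H eps Heps) as (K & L & HK & HL & HE).
  assert (HKR : 0 < INR K) by now apply lt_0_INR.
  assert (Hinv : 0 < / INR K) by now apply Rinv_0_lt_compat.
  (* A null set asks for an infinite sequence of boxes; past the end of [L] they have width 0, hence
     volume 0. *)
  set (w k := if (k <? length L)%nat then / INR K else 0).
  set (a k i := IZR (nth i (nth k L nil) 0%Z) * / INR K).
  exists a, (fun k i => a k i + w k). split; [| split].
  - intros k i. unfold w. destruct (k <? length L)%nat; lra.
  - intros x Hx. destruct (In_nth _ _ nil (HE x Hx)) as [k [Hk Hnth]].
    exists k. intros i Hi. unfold w, a.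
    destruct (Nat.ltb_spec k (length L)) as [_ | ]; [| lia]. rewrite Hnth.
    unfold cell. rewrite (nth_indep _ 0%Z (Int_part (INR K * x O)))
      by (rewrite length_map, length_seq; lia).
    rewrite (map_nth (fun i => Int_part (INR K * x i))), seq_nth by lia. simpl Nat.add.
    destruct (base_Int_part (INR K * x i)) as [H1 H2].
    set (t := IZR (Int_part (INR K * x i))) in *.
    assert (Hx' : x i = INR K * x i * / INR K) by (field; apply Rgt_not_eq; assumption).
    rewrite Hx'. clearbody t. clear Hx'. split.
    + apply Rmult_le_compat_r; lra.
    + replace (t * / INR K + / INR K) with ((t + 1) * / INR K) by ring.
      apply Rmult_le_compat_r; lra.
  - intros K'.
    assert (Hv : forall k, box_vol n (a k) (fun i => a k i + w k) = w k ^ n).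
    { intros k. unfold box_vol. rewrite <- rprod_const. apply rprod_ext. intros; lra. }
    rewrite (rsum_ext _ (fun k => w k ^ n)) by (intros; apply Hv).
    apply Rle_trans with (INR (length L) * (/ INR K) ^ n).
    + assert (Hge : forall k, 0 <= w k ^ n)
        by (intros k; apply pow_le; unfold w; destruct (k <? length L)%nat; lra).
      assert (Hle : forall q, rsum (fun k => w k ^ n) q <= INR (min q (length L)) * (/ INR K) ^ n).
      { induction q; [unfold rsum; simpl; lra |]. rewrite rsum_S.
        unfold w at 2. destruct (Nat.ltb_spec q (length L)).
        - replace (min (S q) (length L)) with (S (min q (length L))) by lia.
          rewrite S_INR. lra.
        - rewrite pow_i by assumption.
          replace (min (S q) (length L)) with (min q (length L)) by lia. lra. }
      eapply Rle_trans; [apply Hle |]. apply Rmult_le_compat_r; [apply pow_le; lra |].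
      apply le_INR. lia.
    + rewrite pow_inv. apply Rmult_le_reg_r with (INR K ^ n); [now apply pow_lt |].
      rewrite Rmult_assoc, Rinv_l by (apply pow_nonzero; lra). lra.
Qed.

(** * Slicing a grid cover *)

Definition join (n : nat) (a z : nat -> R) (i : nat) : R :=
  if (i <? n)%nat then a i else z (i - n)%nat.

Lemma cell_join K n k a z : cell K (n + k) (join n a z) = cell K n a ++ cell K k z.
Proof.
  unfold cell. rewrite seq_app, map_app. f_equal.
  - apply map_ext_in. intros i Hi. apply in_seq in Hi. unfold join.
    destruct (Nat.ltb_spec i n); [reflexivity | lia].
  - assert (Hs : forall s, map (fun i => Int_part (INR K * join n a z i)) (seq (n + s) k)
        = map (fun i => Int_part (INR K * z i)) (seq s k)).
    { induction k; intros s; [reflexivity |]. simpl. f_equal.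
      - unfold join. destruct (Nat.ltb_spec (n + s) n); [lia |]. do 3 f_equal. lia.
      - rewrite <- (IHk (S s)). now rewrite <- plus_n_Sm. }
    specialize (Hs O). now rewrite Nat.add_0_r in Hs.
Qed.

(** The fibres over distinct values are disjoint, so each element of [L] is counted at most once. *)
Lemma sum_fibers_le {T U} (eq_dec : forall x y : U, {x = y} + {x <> y}) (f : T -> U) L H :
  NoDup H ->
  (list_sum (map (fun u => length (filter (fun c => if eq_dec (f c) u then true else false) L)) H)
   <= length L)%nat.
Proof.
  intros HH. induction L as [| c L IH].
  - simpl. clear. induction H; simpl; lia.
  - simpl length at 2.
    enough (Hone : (list_sum (map (fun u => length (filter (fun c => if eq_dec (f c) u then true else false) (c :: L))) H)
      <= 1 + list_sum (map (fun u => length (filter (fun c => if eq_dec (f c) u then true else false) L)) H))%nat) by lia.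
    clear IH. assert (Hone : (list_sum (map (fun u => length (filter (fun c => if eq_dec (f c) u then true else false) (c :: L))) H)
      = (if in_dec eq_dec (f c) H then 1 else 0) + list_sum (map (fun u => length (filter (fun c => if eq_dec (f c) u then true else false) L)) H))%nat).
    { induction HH as [| u H Hu HH IH]; [reflexivity |].
      cbn [map list_sum fold_right] in *. unfold list_sum in *. rewrite IH. clear IH. simpl filter at 1.
      destruct (eq_dec (f c) u) as [e | ne].
      - destruct (in_dec eq_dec (f c) H); [subst; contradiction |].
        destruct (in_dec eq_dec (f c) (u :: H)) as [| n0]; [simpl; lia |].
        destruct n0. now left.
      - destruct (in_dec eq_dec (f c) H) as [i | i]; destruct (in_dec eq_dec (f c) (u :: H)) as [i' | i'].
        + lia.
        + destruct i'. now right.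
        + destruct i'; [congruence | contradiction].
        + lia. }
    rewrite Hone. destruct (in_dec eq_dec (f c) H); lia.
Qed.

(* Markov's inequality on the grid: only few cells of [R^n] can carry many of
   the cells covering [E]. *)
Lemma heavy_sections_content_zero n k E delta :
  0 < delta -> content_zero (n + k) E ->
  content_zero n (fun a => ~ coverable k delta (fun z => E (join n a z))).
Proof.
  intros Hd HE eps Heps.
  (* Each heavy cell uses more than [delta * K^k] of the at most [eps * delta * K^(n+k)] cells,
     which leaves room for at most [eps * K^n] heavy cells. *)
  destruct (HE (eps * delta)) as (K & L & HK & HL & HC); [now apply Rmult_lt_0_compat |].
  pose proof (list_eq_dec Z.eq_dec) as dec.
  set (cnt u := length (filter (fun c => if dec (firstn n c) u then true else false) L)).
  set (heavy u := if Rlt_dec (delta * INR K ^ k) (INR (cnt u)) then true else false).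
  set (H := filter heavy (nodup dec (map (firstn n) L))).
  assert (HKR : 0 < INR K) by now apply lt_0_INR.
  exists K, H. split; [assumption | split].
  - assert (Hsum : (list_sum (map cnt H) <= length L)%nat)
      by (apply sum_fibers_le, NoDup_filter, NoDup_nodup).
    assert (Hlow : INR (length H) * (delta * INR K ^ k) <= INR (list_sum (map cnt H))).
    { assert (Hall : forall u, In u H -> delta * INR K ^ k < INR (cnt u)).
      { intros u Hu. apply filter_In in Hu. destruct Hu as [_ Hu]. unfold heavy in Hu.
        destruct (Rlt_dec (delta * INR K ^ k) (INR (cnt u))); [assumption | discriminate]. }
      clear Hsum. induction H as [| u H IH]; [simpl; lra |].
      cbn [length map]. change (list_sum (cnt u :: map cnt H)) with (cnt u + list_sum (map cnt H))%nat.
      rewrite S_INR, plus_INR.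
      assert (delta * INR K ^ k < INR (cnt u)) by (apply Hall; now left).
      assert (INR (length H) * (delta * INR K ^ k) <= INR (list_sum (map cnt H)))
        by (apply IH; intros; apply Hall; now right).
      lra. }
    apply le_INR in Hsum.
    assert (HKk : 0 < INR K ^ k) by now apply pow_lt.
    apply Rmult_le_reg_r with (delta * INR K ^ k); [now apply Rmult_lt_0_compat |].
    eapply Rle_trans; [exact Hlow |]. eapply Rle_trans; [exact Hsum |].
    eapply Rle_trans; [exact HL |]. rewrite pow_add. right. ring.
  - intros a Ha. apply filter_In.
    assert (Hlen : length (cell K n a) = n) by (unfold cell; now rewrite length_map, length_seq).
    destruct (Rlt_dec (delta * INR K ^ k) (INR (cnt (cell K n a)))) as [Hlt | Hge].
    + split; [| unfold heavy; now destruct (Rlt_dec (delta * INR K ^ k) (INR (cnt (cell K n a))))].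
      apply nodup_In. apply NNPP. intros Hn.
      assert (Hz : cnt (cell K n a) = O).
      { unfold cnt. destruct (filter _ L) as [| c F] eqn:HF; [reflexivity |].
        destruct Hn. assert (Hc : In c (c :: F)) by now left. rewrite <- HF in Hc.
        apply filter_In in Hc. destruct Hc as [Hc He].
        destruct (dec (firstn n c) (cell K n a)); [| discriminate].
        apply in_map_iff. now exists c. }
      rewrite Hz in Hlt. assert (0 < delta * INR K ^ k) by (apply Rmult_lt_0_compat; [| apply pow_lt]; assumption).
      simpl in Hlt. lra.
    + destruct Ha. apply Rnot_lt_le in Hge.
      (* Over a light cell, the last [k] indices of the cells of [L] lying above it cover the
         section. *)
      exists K, (map (skipn n) (filter (fun c => if dec (firstn n c) (cell K n a) then true else false) L)).
      split; [assumption | split].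
      * rewrite length_map. exact Hge.
      * intros z Hz. apply in_map_iff. exists (cell K (n + k) (join n a z)).
        rewrite cell_join. split.
        -- rewrite skipn_app, Hlen, Nat.sub_diag, skipn_all2 by lia. reflexivity.
        -- apply filter_In. split; [rewrite <- cell_join; now apply HC |].
           rewrite firstn_app, Hlen, Nat.sub_diag, firstn_all2 by lia. simpl firstn.
           rewrite app_nil_r. now destruct (dec (cell K n a) (cell K n a)).
Qed.

(** A section that is not null fails to be coverable for some tolerance [1/(q+1)]. For each [q] the
    parameters of such sections have content zero; their union over [q] is only claimed to be
    null. *)
Lemma nullset_sections n k E :
  (0 < n)%nat -> (0 < k)%nat -> content_zero (n + k) E ->
  nullset n (fun a => ~ nullset k (fun z => E (join n a z))).
Proof.
  intros Hn Hk HE.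
  apply nullset_subset with
    (fun a => exists q : nat, ~ coverable k (/ INR (S q)) (fun z => E (join n a z))).
  - intros a Ha. apply NNPP. intros Hno. apply Ha. apply content_zero_nullset; [assumption |].
    intros eps Heps. destruct (archimed_cor1 eps Heps) as [q [Hq Hq0]].
    destruct q as [| q]; [lia |].
    assert (Hc : coverable k (/ INR (S q)) (fun z => E (join n a z)))
      by (apply NNPP; intros Hc; apply Hno; now exists q).
    destruct Hc as (K & L & H1 & H2 & H3). exists K, L. split; [assumption | split; [| assumption]].
    eapply Rle_trans; [exact H2 |]. apply Rmult_le_compat_r; [apply pow_le, pos_INR | lra].
  - apply (nullset_union n (fun q a => ~ coverable k (/ INR (S q)) (fun z => E (join n a z)))).
    intros q. apply content_zero_nullset; [assumption |].
    apply heavy_sections_content_zero; [| assumption].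
    apply Rinv_0_lt_compat, lt_0_INR. lia.
Qed.

(** * Compact sets that are thin along an axis *)

Lemma Rabs_le_bounds a b : Rabs a <= b -> - b <= a <= b.
Proof. unfold Rabs. destruct (Rcase_abs a); lra. Qed.

Lemma Un_cv_eq (u v : nat -> R) l : (forall k, u k = v k) -> Un_cv u l -> Un_cv v l.
Proof.
  intros H Hu eps Heps. destruct (Hu eps Heps) as [q Hq]. exists q.
  intros k Hk. rewrite <- H. auto.
Qed.

Definition converges (D : nat) (u : nat -> nat -> R) (l : nat -> R) : Prop :=
  forall i, (i < D)%nat -> Un_cv (fun k => u k i) (l i).

(** Convergence concerns the first [D] coordinates only. Constant sequences then show that such an
    [F] depends on these coordinates alone, so the values of a vector beyond [D] never matter. *)
Definition scont (D : nat) (F : (nat -> R) -> R) : Prop :=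
  forall u l, converges D u l -> Un_cv (fun k => F (u k)) (F l).

Definition sclosed (D : nat) (P : (nat -> R) -> Prop) : Prop :=
  forall u l, converges D u l -> (forall k, P (u k)) -> P l.

Lemma Un_cv_subseq u l (phi : nat -> nat) :
  (forall k, (k <= phi k)%nat) -> Un_cv u l -> Un_cv (fun k => u (phi k)) l.
Proof.
  intros H Hu eps Heps. destruct (Hu eps Heps) as [q Hq]. exists q.
  intros k Hk. apply Hq. specialize (H k). lia.
Qed.

Lemma Un_cv_const c : Un_cv (fun _ => c) c.
Proof.
  intros eps Heps. exists O. intros. now rewrite Rdist_eq.
Qed.

Lemma Un_cv_inv_S u l :
  (forall k, Rabs (u k - l) <= / INR (S k)) -> Un_cv u l.
Proof.
  intros H eps Heps. destruct (archimed_cor1 eps Heps) as [q [Hq Hq0]].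
  exists q. intros k Hk. unfold Rdist. eapply Rle_lt_trans; [apply H |].
  eapply Rle_lt_trans; [| exact Hq]. apply Rinv_le_contravar.
  - now apply lt_0_INR.
  - apply le_INR. lia.
Qed.

Lemma Un_cv_le u v a b :
  (forall k, u k <= v k) -> Un_cv u a -> Un_cv v b -> a <= b.
Proof.
  intros H Ha Hb. destruct (Rle_lt_dec a b) as [| Hlt]; [assumption |].
  destruct (Ha ((a - b) / 2)) as [p Hp]; [lra |].
  destruct (Hb ((a - b) / 2)) as [q Hq]; [lra |].
  specialize (Hp (p + q)%nat ltac:(lia)). specialize (Hq (p + q)%nat ltac:(lia)).
  specialize (H (p + q)%nat). unfold Rdist in *.
  apply Rabs_def2 in Hp. apply Rabs_def2 in Hq. lra.
Qed.

(** The condition [k <= phi k] stands in for strict monotonicity: it is enough to pass to limits and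
    is stable under composition. *)
Lemma bolzano_weierstrass_R (u : nat -> R) M :
  (forall k, Rabs (u k) <= M) ->
  exists phi l, (forall k, (k <= phi k)%nat) /\ Un_cv (fun k => u (phi k)) l.
Proof.
  intros H.
  destruct (Bolzano_Weierstrass u (fun c => - M <= c <= M)) as [l Hl].
  - apply compact_P3.
  - intros k. specialize (H k). apply Rabs_le_bounds in H. lra.
  - assert (Hc : forall k, exists q, (k <= q)%nat /\ Rabs (u q - l) < / INR (S k)).
    { intros k. assert (Hk : 0 < / INR (S k)) by (apply Rinv_0_lt_compat, lt_0_INR; lia).
      destruct (Hl (disc l (mkposreal _ Hk)) k) as [q [Hq Hd]].
      - exists (mkposreal _ Hk). intros x Hx. exact Hx.
      - exists q. split; assumption. }
    apply functional_choice in Hc. destruct Hc as [phi Hphi].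
    exists phi, l. split; [intros; apply Hphi |].
    apply Un_cv_inv_S. intros k. left. apply Hphi.
Qed.

Lemma bolzano_weierstrass D (u : nat -> nat -> R) M :
  (forall k i, (i < D)%nat -> Rabs (u k i) <= M) ->
  exists phi l, (forall k, (k <= phi k)%nat) /\ converges D (fun k => u (phi k)) l.
Proof.
  induction D; intros H.
  - exists (fun k => k), (fun _ => 0). split; [lia | intros i Hi; lia].
  - destruct IHD as (phi & l & Hphi & Hl); [auto with arith |].
    destruct (bolzano_weierstrass_R (fun k => u (phi k) D) M) as (psi & c & Hpsi & Hc).
    + intros k. apply H. lia.
    + exists (fun k => phi (psi k)), (fun i => if (i =? D)%nat then c else l i). split.
      * intros k. specialize (Hpsi k). specialize (Hphi (psi k)). lia.
      * intros i Hi. destruct (Nat.eqb_spec i D) as [-> | Hne]; [exact Hc |].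
        apply (Un_cv_subseq (fun k => u (phi k) i)); [assumption | apply Hl; lia].
Qed.

Lemma converges_subseq D u l (phi : nat -> nat) :
  (forall k, (k <= phi k)%nat) -> converges D u l -> converges D (fun k => u (phi k)) l.
Proof.
  intros H Hu i Hi. apply (Un_cv_subseq (fun k => u k i)); auto.
Qed.

Lemma scont_coord D i : (i < D)%nat -> scont D (fun w => w i).
Proof. intros Hi u l H. now apply H. Qed.

Lemma scont_const D c : scont D (fun _ => c).
Proof. intros u l H. apply Un_cv_const. Qed.

Lemma scont_plus D F G : scont D F -> scont D G -> scont D (fun w => F w + G w).
Proof. intros HF HG u l H. apply (CV_plus (fun k => F (u k)) (fun k => G (u k))); auto. Qed.

Lemma scont_minus D F G : scont D F -> scont D G -> scont D (fun w => F w - G w).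
Proof. intros HF HG u l H. apply (CV_minus (fun k => F (u k)) (fun k => G (u k))); auto. Qed.

Lemma scont_mult D F G : scont D F -> scont D G -> scont D (fun w => F w * G w).
Proof. intros HF HG u l H. apply (CV_mult (fun k => F (u k)) (fun k => G (u k))); auto. Qed.

Lemma scont_abs D F : scont D F -> scont D (fun w => Rabs (F w)).
Proof. intros HF u l H. apply (cv_cvabs (fun k => F (u k))); auto. Qed.

Lemma scont_rsum D (F : nat -> (nat -> R) -> R) n :
  (forall i, (i < n)%nat -> scont D (F i)) -> scont D (fun w => rsum (fun i => F i w) n).
Proof.
  induction n; intros H.
  - apply (scont_const D 0).
  - intros u l Hu. rewrite rsum_S.
    apply Un_cv_eq with (fun k => rsum (fun i => F i (u k)) n + F n (u k)).
    + intros k. now rewrite rsum_S.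
    + apply (CV_plus (fun k => rsum (fun i => F i (u k)) n) (fun k => F n (u k))).
      * apply IHn; auto with arith.
      * apply H; auto with arith.
Qed.

Lemma sclosed_le D F G : scont D F -> scont D G -> sclosed D (fun w => F w <= G w).
Proof.
  intros HF HG u l Hu H.
  apply Un_cv_le with (fun k => F (u k)) (fun k => G (u k)); auto.
Qed.

Lemma sclosed_and D P Q : sclosed D P -> sclosed D Q -> sclosed D (fun w => P w /\ Q w).
Proof.
  intros HP HQ u l Hu H. split; [apply (HP u) | apply (HQ u)]; auto; intros; apply H.
Qed.

Lemma sclosed_eq D F G : scont D F -> scont D G -> sclosed D (fun w => F w = G w).
Proof.
  intros HF HG u l Hu H. apply Rle_antisym.
  - apply (sclosed_le D F G HF HG u); auto. intros k. rewrite (H k). lra.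
  - apply (sclosed_le D G F HG HF u); auto. intros k. rewrite (H k). lra.
Qed.

Lemma sclosed_forall D (T : Type) (P : T -> (nat -> R) -> Prop) :
  (forall t, sclosed D (P t)) -> sclosed D (fun w => forall t, P t w).
Proof. intros H u l Hu Hk t. apply (H t u); auto. Qed.

Lemma sclosed_imp D (P : Prop) (Q : (nat -> R) -> Prop) :
  (P -> sclosed D Q) -> sclosed D (fun w => P -> Q w).
Proof. intros H u l Hu Hk HP. apply (H HP u); auto. Qed.

(** * Counting the cells met by a thin set *)

Fixpoint choices (S : nat -> list Z) (l : list nat) : list (list Z) :=
  match l with
  | nil => [nil]
  | i :: l => flat_map (fun a => map (cons a) (choices S l)) (S i)
  end.

Lemma length_flat_map_const {T U} (f : T -> list U) l c :
  (forall t, In t l -> length (f t) = c) -> length (flat_map f l) = (length l * c)%nat.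
Proof.
  induction l; intros H; [reflexivity |]. simpl. rewrite length_app, IHl, H; simpl in *; auto.
Qed.

Lemma in_choices S (f : nat -> Z) l :
  (forall i, In i l -> In (f i) (S i)) -> In (map f l) (choices S l).
Proof.
  induction l; intros H; [now left |]. simpl. apply in_flat_map.
  exists (f a). split; [apply H; now left |]. apply in_map. apply IHl.
  intros i Hi. apply H. now right.
Qed.

(** Coordinate [i0] has one choice and every other has [W]. Multiplying by [W] when [i0] occurs
    avoids an exponent [length l - 1] and lets the induction pass through lists without [i0]. *)
Lemma length_choices S l W i0 :
  (forall i, i <> i0 -> length (S i) = W) -> length (S i0) = 1%nat -> NoDup l ->
  (length (choices S l) * (if in_dec Nat.eq_dec i0 l then W else 1) = W ^ length l)%nat.
Proof.
  intros HS H0 Hl. induction Hl as [| i l Hi Hl IH]; [reflexivity |].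
  simpl choices. rewrite (length_flat_map_const _ _ (length (choices S l))) by (intros; apply length_map).
  simpl length. rewrite Nat.pow_succ_r', <- IH.
  destruct (Nat.eq_dec i i0) as [-> | Hne].
  - rewrite H0. destruct (in_dec Nat.eq_dec i0 l); [contradiction |].
    destruct (in_dec Nat.eq_dec i0 (i0 :: l)) as [_ | n']; [nia | destruct n'; now left].
  - rewrite (HS i Hne).
    destruct (in_dec Nat.eq_dec i0 l) as [y | y]; destruct (in_dec Nat.eq_dec i0 (i :: l)) as [y' | y'];
      try (destruct y'; now right); try (destruct y'; congruence); try nia.
Qed.

Definition zrange (lo : Z) (len : nat) : list Z :=
  map (fun t => (lo + Z.of_nat t)%Z) (seq 0 len).

Lemma in_zrange lo len z : (lo <= z < lo + Z.of_nat len)%Z -> In z (zrange lo len).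
Proof.
  intros H. apply in_map_iff. exists (Z.to_nat (z - lo)). split; [lia |].
  apply in_seq. lia.
Qed.

Lemma length_zrange lo len : length (zrange lo len) = len.
Proof. unfold zrange. now rewrite length_map, length_seq. Qed.

Lemma Int_part_diff_le a b (q : nat) :
  Rabs (a - b) <= INR q -> (Z.abs (Int_part a - Int_part b) <= Z.of_nat q)%Z.
Proof.
  intros H. apply Rabs_le_bounds in H. rewrite INR_IZR_INZ in H.
  destruct (base_Int_part a), (base_Int_part b).
  assert (IZR (Int_part a - Int_part b) < IZR (Z.of_nat q + 1))
    by (rewrite minus_IZR, plus_IZR; lra).
  assert (IZR (- (Z.of_nat q + 1)) < IZR (Int_part a - Int_part b))
    by (rewrite minus_IZR, opp_IZR, plus_IZR; lra).
  apply lt_IZR in H4. apply lt_IZR in H5. lia.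
Qed.

(** Group the cells by their indices off [i0]. Points in one group are close off [i0], hence close
    at [i0], so a group occupies a short column of cells and contributes a small fraction of its
    full height. *)
Lemma thin_content_zero n i0 (M : nat) E :
  (i0 < n)%nat ->
  (forall x, E x -> forall i, (i < n)%nat -> Rabs (x i) <= INR M) ->
  (forall eps, 0 < eps -> exists delta, 0 < delta /\ forall x y, E x -> E y ->
     (forall i, (i < n)%nat -> i <> i0 -> Rabs (x i - y i) <= delta) ->
     Rabs (x i0 - y i0) <= eps) ->
  content_zero n E.
Proof.
  intros Hi0 HM HE eps Heps. destruct n as [| n]; [lia |].
  (* After the shift [n] is the number of coordinates other than [i0]. There are at most
     [((2M+1) K)^n] groups with at most [3Q] cells each, and [Q = K/P], so the total is at most
     [(C/P) K^(n+1)]. *)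
  set (C := 3 * INR (2 * M + 1) ^ n).
  assert (HC : 0 < C).
  { unfold C. apply Rmult_lt_0_compat; [lra |]. apply pow_lt, lt_0_INR. lia. }
  destruct (archimed_cor1 (eps / C)) as [P [HP HP0]]; [now apply Rdiv_lt_0_compat |].
  assert (HPR : 0 < INR P) by now apply lt_0_INR.
  destruct (HE (/ INR P)) as [delta [Hd HE']]; [now apply Rinv_0_lt_compat |].
  destruct (archimed_cor1 delta Hd) as [Q [HQ HQ0]].
  assert (HQR : 0 < INR Q) by now apply lt_0_INR.
  (* Mesh [1/K] is at most [1/Q < delta], so sharing a group gives closeness off [i0]; the resulting
     spread [1/P] at [i0] amounts to exactly [Q] cells. *)
  set (K := (P * Q)%nat).
  assert (HKR : 0 < INR K) by (apply lt_0_INR; unfold K; nia).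
  set (W := (2 * M * K + 1)%nat).
  set (base x := map (fun i => if (i =? i0)%nat then 0%Z else Int_part (INR K * x i)) (seq 0 (S n))).
  (* The reference height [g] of a group is the [i0]-index of any one point in it, or 0 for an empty
     group. *)
  assert (Hg : forall b, exists g, forall x, E x -> base x = b ->
    (Z.abs (Int_part (INR K * x i0) - g) <= Z.of_nat Q)%Z).
  { intros b. destruct (classic (exists y, E y /\ base y = b)) as [[y [Hy Hb]] | Hno].
    - exists (Int_part (INR K * y i0)). intros x Hx Hxb. apply Int_part_diff_le.
      rewrite <- Rmult_minus_distr_l, Rabs_mult, (Rabs_pos_eq (INR K)) by lra.
      replace (INR Q) with (INR K * / INR P) by (unfold K; rewrite mult_INR; field; lra).
      apply Rmult_le_compat_l; [lra |]. apply HE'; auto.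
      intros i Hi Hne.
      assert (Hcell : Int_part (INR K * x i) = Int_part (INR K * y i)).
      { rewrite <- Hxb in Hb. unfold base in Hb.
        assert (Hin : In i (seq 0 (S n))) by (apply in_seq; lia).
        pose proof (ext_in_map Hb i Hin) as Hbi. simpl in Hbi.
        destruct (Nat.eqb_spec i i0); [contradiction | auto]. }
      destruct (base_Int_part (INR K * x i)) as [H1 H2].
      destruct (base_Int_part (INR K * y i)) as [H3 H4].
      rewrite Hcell in H1, H2.
      assert (Hlt : Rabs (INR K * (x i - y i)) <= 1) by (apply Rabs_le; lra).
      rewrite Rabs_mult, (Rabs_pos_eq (INR K)) in Hlt by lra.
      apply Rle_trans with (/ INR Q); [| lra].
      apply Rmult_le_reg_l with (INR K); [assumption |].
      eapply Rle_trans; [exact Hlt |]. unfold K. rewrite mult_INR.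
      replace (INR P * INR Q * / INR Q) with (INR P) by (field; lra).
      apply (le_INR 1). lia.
    - exists 0%Z. intros x Hx Hb. destruct Hno. now exists x. }
  apply functional_choice in Hg. destruct Hg as [g Hg].
  set (ins b t := map (fun i => if (i =? i0)%nat then t else nth i b 0%Z) (seq 0 (S n))).
  set (bases := choices (fun i => if (i =? i0)%nat then [0%Z] else zrange (- Z.of_nat (M * K)) W) (seq 0 (S n))).
  exists K, (flat_map (fun b => map (ins b) (zrange (g b - Z.of_nat Q) (2 * Q + 1))) bases).
  split; [unfold K; nia | split].
  - rewrite (length_flat_map_const _ _ (2 * Q + 1))
      by (intros; rewrite length_map; apply length_zrange).
    assert (HW : length bases = (W ^ n)%nat).
    { pose proof (length_choices (fun i => if (i =? i0)%nat then [0%Z] else zrange (- Z.of_nat (M * K)) W)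
        (seq 0 (S n)) W i0) as Hlen.
      destruct (in_dec Nat.eq_dec i0 (seq 0 (S n))) as [_ | Hn]; [| destruct Hn; apply in_seq; lia].
      rewrite length_seq, Nat.pow_succ_r' in Hlen.
      apply Nat.mul_cancel_l with W; [unfold W; lia |].
      rewrite (Nat.mul_comm W (length bases)). apply Hlen.
      - intros i Hi. destruct (Nat.eqb_spec i i0); [contradiction | apply length_zrange].
      - now rewrite Nat.eqb_refl.
      - apply seq_NoDup. }
    rewrite HW.
    assert (H1 : INR W <= INR (2 * M + 1) * INR K)
      by (rewrite <- mult_INR; apply le_INR; unfold W, K; nia).
    assert (H2 : INR (2 * Q + 1) <= 3 * INR Q)
      by (replace 3 with (INR 3) by (simpl; lra); rewrite <- mult_INR; apply le_INR; lia).
    rewrite mult_INR, pow_INR.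
    apply Rle_trans with ((INR (2 * M + 1) * INR K) ^ n * (3 * INR Q)).
    { apply Rmult_le_compat; [apply pow_le, pos_INR | apply pos_INR | | assumption].
      apply pow_incr. split; [apply pos_INR | assumption]. }
    rewrite Rpow_mult_distr, <- tech_pow_Rmult.
    replace (INR (2 * M + 1) ^ n * INR K ^ n * (3 * INR Q)) with (C * / INR P * (INR K * INR K ^ n))
      by (unfold C, K; rewrite !mult_INR; field; lra).
    apply Rmult_le_compat_r; [left; apply Rmult_lt_0_compat; [| apply pow_lt]; assumption |].
    apply Rle_trans with (C * (eps / C)); [apply Rmult_le_compat_l; lra |].
    right. field. lra.
  - intros x Hx. apply in_flat_map. exists (base x). split.
    + unfold base, bases. apply in_choices. intros i Hi. apply in_seq in Hi.
      destruct (Nat.eqb_spec i i0); [now left |]. apply in_zrange.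
      pose proof (HM x Hx i ltac:(lia)) as Hb.
      assert (Hb' : Rabs (INR K * x i) <= INR (M * K)).
      { rewrite Rabs_mult, (Rabs_pos_eq (INR K)), mult_INR, (Rmult_comm (INR M)) by lra.
        apply Rmult_le_compat_l; lra. }
      apply Rabs_le_bounds in Hb'. rewrite INR_IZR_INZ in Hb'.
      destruct (base_Int_part (INR K * x i)) as [H1 H2].
      assert (Ha : IZR (- Z.of_nat (M * K) - 1) < IZR (Int_part (INR K * x i)))
        by (rewrite minus_IZR, opp_IZR; lra).
      assert (Hc : IZR (Int_part (INR K * x i)) <= IZR (Z.of_nat (M * K))) by lra.
      apply lt_IZR in Ha. apply le_IZR in Hc. unfold W. lia.
    + apply in_map_iff. exists (Int_part (INR K * x i0)). split.
      * unfold ins, cell. apply map_ext_in. intros i Hi. apply in_seq in Hi.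
        destruct (Nat.eqb_spec i i0) as [-> | Hne]; [reflexivity |]. unfold base.
        set (f := fun i => if (i =? i0)%nat then 0%Z else Int_part (INR K * x i)).
        rewrite (nth_indep _ 0%Z (f O)) by (rewrite length_map, length_seq; lia).
        rewrite map_nth, seq_nth by lia. unfold f. simpl Nat.add.
        destruct (Nat.eqb_spec i i0); [contradiction | reflexivity].
      * apply in_zrange. pose proof (Hg (base x) x Hx eq_refl). lia.
Qed.

(* By compactness the uniqueness hypothesis self-improves to the uniform
   thinness required by [thin_content_zero]. *)
Lemma graph_content_zero n D i0 (M : nat) (Phi : (nat -> R) -> Prop) :
  (i0 < n)%nat -> (n <= D)%nat -> sclosed D Phi ->
  (forall w w', Phi w -> Phi w' ->
     (forall i, (i < n)%nat -> i <> i0 -> w i = w' i) -> w i0 = w' i0) ->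
  content_zero n (fun x => exists w, Phi w /\
    (forall i, (i < D)%nat -> Rabs (w i) <= INR M) /\
    (forall i, (i < n)%nat -> x i = w i)).
Proof.
  intros Hi0 HnD Hcl Huniq. apply thin_content_zero with i0 M; [assumption | |].
  - intros x (w & _ & Hw & Hx) i Hi. rewrite Hx by assumption. apply Hw. lia.
  - intros eps Heps. apply NNPP. intros Hno.
    assert (Hc : forall k : nat, exists ww : (nat -> R) * (nat -> R),
      (Phi (fst ww) /\ forall i, (i < D)%nat -> Rabs (fst ww i) <= INR M) /\
      (Phi (snd ww) /\ forall i, (i < D)%nat -> Rabs (snd ww i) <= INR M) /\
      (forall i, (i < n)%nat -> i <> i0 -> Rabs (fst ww i - snd ww i) <= / INR (S k)) /\
      eps <= Rabs (fst ww i0 - snd ww i0)).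
    { intros k. apply NNPP. intros Hk. apply Hno. exists (/ INR (S k)).
      split; [apply Rinv_0_lt_compat, lt_0_INR; lia |].
      intros x y (w & Hw & Hwb & Hx) (w' & Hw' & Hwb' & Hy) Hclose.
      apply Rnot_lt_le. intros Hlt. apply Hk. exists (w, w'). simpl.
      rewrite Hx, Hy in Hlt by assumption.
      repeat split; auto; [| lra].
      intros i Hi Hne. rewrite <- Hx, <- Hy by assumption. auto. }
    apply functional_choice in Hc. destruct Hc as [ww Hww].
    destruct (bolzano_weierstrass D (fun k => fst (ww k)) (INR M)) as (phi & l & Hphi & Hl).
    { intros k. apply (Hww k). }
    destruct (bolzano_weierstrass D (fun k => snd (ww (phi k))) (INR M)) as (psi & l' & Hpsi & Hl').
    { intros k. apply (Hww (phi k)). }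
    (* Both halves of the pairs now converge along the same indices. Their limits satisfy the closed
       condition [Phi] and agree off [i0], yet remain at distance at least [eps] at [i0]. *)
    apply converges_subseq with (phi := psi) in Hl; [| assumption].
    assert (Heq : l i0 = l' i0).
    { apply Huniq.
      - apply (Hcl _ _ Hl). intros k. apply (Hww (phi (psi k))).
      - apply (Hcl _ _ Hl'). intros k. apply (Hww (phi (psi k))).
      - intros i Hi Hne. apply Rminus_diag_uniq.
        apply UL_sequence with (fun k => fst (ww (phi (psi k))) i - snd (ww (phi (psi k))) i).
        + apply (CV_minus (fun k => fst (ww (phi (psi k))) i) (fun k => snd (ww (phi (psi k))) i));
            [apply Hl | apply Hl']; lia.
        + apply (Un_cv_subseq (fun q => fst (ww q) i - snd (ww q) i) 0 (fun k => phi (psi k))).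
          * intros k. specialize (Hpsi k). specialize (Hphi (psi k)). lia.
          * apply Un_cv_inv_S. intros k. rewrite Rminus_0_r. now apply (Hww k). }
    assert (Hle : eps <= Rabs (l i0 - l' i0)).
    { apply (Un_cv_le (fun _ => eps) (fun k => Rabs (fst (ww (phi (psi k))) i0 - snd (ww (phi (psi k))) i0))).
      - intros k. apply (Hww (phi (psi k))).
      - apply Un_cv_const.
      - apply (cv_cvabs (fun k => fst (ww (phi (psi k))) i0 - snd (ww (phi (psi k))) i0)).
        apply (CV_minus (fun k => fst (ww (phi (psi k))) i0) (fun k => snd (ww (phi (psi k))) i0));
          [apply Hl | apply Hl']; lia. }
    rewrite Heq, Rminus_diag, Rabs_R0 in Hle. lra.
Qed.

(** * Signed powers and optimality conditions *)

Lemma Rabs_zero_inv t : Rabs t = 0 -> t = 0.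
Proof. unfold Rabs. destruct (Rcase_abs t); lra. Qed.

(** The odd power [sgn(t) |t|^r]. The sign cases are explicit because [Rpower] is meaningful for
    positive bases only. Up to a factor [r + 1] it is the derivative of
    [|t|^(r+1) = t * spow r t]. *)
Definition spow (r t : R) : R :=
  if Rlt_dec 0 t then Rpower t r
  else if Rlt_dec t 0 then - Rpower (- t) r else 0.

Lemma spow_pos r t : 0 < t -> spow r t = Rpower t r.
Proof. intros H. unfold spow. destruct (Rlt_dec 0 t); [reflexivity | lra]. Qed.

Lemma spow_0 r : spow r 0 = 0.
Proof. unfold spow. destruct (Rlt_dec 0 0); [lra |]. reflexivity. Qed.

Lemma spow_opp r t : spow r (- t) = - spow r t.
Proof.
  unfold spow. destruct (Rlt_dec 0 t), (Rlt_dec t 0), (Rlt_dec 0 (- t)), (Rlt_dec (- t) 0);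
    try lra; rewrite ?Ropp_involutive; lra.
Qed.

Lemma spow_gt0 r t : 0 < t -> 0 < spow r t.
Proof. intros H. rewrite spow_pos by assumption. apply exp_pos. Qed.

Lemma spow_lt r s t : 0 < r -> s < t -> spow r s < spow r t.
Proof.
  intros Hr Hst.
  assert (Hpos : forall a b, 0 <= a -> a < b -> spow r a < spow r b).
  { intros a b [Ha | <-] Hab.
    - rewrite !spow_pos by lra. apply Rlt_Rpower_l; lra.
    - rewrite spow_0. now apply spow_gt0. }
  destruct (Rle_lt_dec 0 s) as [Hs | Hs]; [now apply Hpos |].
  assert (H1 : 0 < spow r (- s)) by (apply spow_gt0; lra). rewrite spow_opp in H1.
  destruct (Rlt_le_dec 0 t) as [Ht | Ht].
  - pose proof (spow_gt0 r t Ht). lra.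
  - assert (H2 : spow r (- t) < spow r (- s)) by (apply Hpos; lra).
    rewrite !spow_opp in H2. lra.
Qed.

Lemma spow_le r s t : 0 < r -> s <= t -> spow r s <= spow r t.
Proof.
  intros Hr [Hst | ->]; [left; now apply spow_lt | lra].
Qed.

Lemma spow_inv r t : r <> 0 -> spow (/ r) (spow r t) = t.
Proof.
  intros Hr.
  assert (Hpos : forall a, 0 < a -> spow (/ r) (spow r a) = a).
  { intros a Ha. rewrite (spow_pos _ (spow r a)) by now apply spow_gt0.
    rewrite spow_pos, Rpower_mult, Rinv_r, Rpower_1 by assumption. reflexivity. }
  destruct (Rtotal_order t 0) as [Ht | [-> | Ht]].
  - rewrite <- (Ropp_involutive t), 2!spow_opp, Hpos by lra. reflexivity.
  - now rewrite !spow_0.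
  - now apply Hpos.
Qed.

Lemma spow_inv' r t : r <> 0 -> spow r (spow (/ r) t) = t.
Proof.
  intros Hr. rewrite <- (Rinv_inv r) at 1. apply spow_inv. now apply Rinv_neq_0_compat.
Qed.

(* A strictly increasing bijection of the line is continuous. *)
Lemma spow_cv r u l : 0 < r -> Un_cv u l -> Un_cv (fun k => spow r (u k)) (spow r l).
Proof.
  intros Hr Hu eps Heps.
  assert (Hr' : 0 < / r) by now apply Rinv_0_lt_compat.
  set (a := spow (/ r) (spow r l - eps)). set (b := spow (/ r) (spow r l + eps)).
  assert (Hl : spow (/ r) (spow r l) = l) by (apply spow_inv; lra).
  assert (Ha : a < l) by (rewrite <- Hl; apply spow_lt; lra).
  assert (Hb : l < b) by (rewrite <- Hl; apply spow_lt; lra).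
  destruct (Hu (Rmin (l - a) (b - l))) as [q Hq]; [apply Rmin_pos; lra |].
  exists q. intros k Hk. specialize (Hq k Hk). unfold Rdist in *.
  pose proof (Rmin_l (l - a) (b - l)). pose proof (Rmin_r (l - a) (b - l)).
  apply Rabs_def2 in Hq.
  assert (H1 : spow r a < spow r (u k)) by (apply spow_lt; lra).
  assert (H2 : spow r (u k) < spow r b) by (apply spow_lt; lra).
  unfold a, b in H1, H2. rewrite spow_inv' in H1, H2 by lra.
  apply Rabs_def1; lra.
Qed.

Lemma scont_spow D r F : 0 < r -> scont D F -> scont D (fun w => spow r (F w)).
Proof. intros Hr HF u l Hu. apply (spow_cv r (fun k => F (u k))); auto. Qed.

Lemma mul_spow_nonneg r t : 0 <= t * spow r t.
Proof.
  destruct (Rtotal_order t 0) as [Ht | [-> | Ht]].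
  - assert (H : 0 < spow r (- t)) by (apply spow_gt0; lra). rewrite spow_opp in H. nra.
  - lra.
  - assert (H : 0 < spow r t) by now apply spow_gt0. nra.
Qed.

Lemma rpow_abs p t : rpow (Rabs t) p = t * spow (p - 1) t.
Proof.
  assert (Hpos : forall a, 0 < a -> Rpower a p = a * Rpower a (p - 1)).
  { intros a Ha. rewrite <- (Rpower_1 a) at 2 by assumption.
    rewrite <- Rpower_plus. f_equal. lra. }
  unfold rpow. destruct (Req_EM_T (Rabs t) 0) as [H0 | H0].
  - apply Rabs_zero_inv in H0. subst. lra.
  - destruct (Rtotal_order t 0) as [Ht | [-> | Ht]].
    + rewrite Rabs_left, Hpos by lra. rewrite <- (Ropp_involutive t) at 3 4.
      rewrite spow_opp, spow_pos by lra. lra.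
    + now rewrite Rabs_R0 in H0.
    + rewrite Rabs_right, Hpos, spow_pos by lra. reflexivity.
Qed.

(* The weighted arithmetic-geometric mean inequality for [exp a] and [exp 0]. *)
Lemma bernoulli_Rpower q u : 1 < q -> 0 < u -> 1 + q * (u - 1) <= Rpower u q.
Proof.
  intros Hq Hu. unfold Rpower. rewrite <- (exp_ln u) at 1 by assumption.
  set (c := ln u).
  pose proof (exp_ineq1_le (q * c - c)) as H1. pose proof (exp_ineq1_le (- c)) as H2.
  assert (E1 : exp (q * c) = exp c * exp (q * c - c)) by (rewrite <- exp_plus; f_equal; lra).
  assert (E2 : 1 = exp c * exp (- c)) by (rewrite <- exp_plus, Rplus_opp_r, exp_0; lra).
  pose proof (exp_pos c).
  assert (H3 : exp c * (1 + (q * c - c)) <= exp (q * c))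
    by (rewrite E1; apply Rmult_le_compat_l; lra).
  assert (H4 : exp c * (1 + - c) <= 1)
    by (rewrite E2 at 2; apply Rmult_le_compat_l; lra).
  (* [H4] reads [exp c - 1 <= c * exp c]; multiplied by [q - 1] and inserted in [H3] it gives the
     claim. *)
  nra.
Qed.

(** Convexity of [|t|^(r+1)]: its graph lies above the tangent at [x]. For [x, w > 0] this is
    Bernoulli's inequality at [w/x], scaled; for [w <= 0 < x] the tangent is already nonpositive;
    negative [x] follows by oddness. *)
Lemma spow_tangent r x w : 0 < r ->
  x * spow r x + (r + 1) * spow r x * (w - x) <= w * spow r w.
Proof.
  intros Hr. pose proof (mul_spow_nonneg r w) as Hw0.
  assert (Hmain : forall x w, 0 < x -> x * spow r x + (r + 1) * spow r x * (w - x) <= w * spow r w).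
  { clear x w Hw0. intros x w Hx. pose proof (mul_spow_nonneg r w) as Hw0.
    pose proof (spow_gt0 r x Hx) as Hsx.
    destruct (Rle_lt_dec w 0) as [Hw | Hw].
    - assert (H : x + (r + 1) * (w - x) <= 0) by nra.
      assert (spow r x * (x + (r + 1) * (w - x)) <= 0) by nra. lra.
    - pose proof (bernoulli_Rpower (r + 1) (w / x)) as Hb.
      specialize (Hb ltac:(lra) ltac:(now apply Rdiv_lt_0_compat)).
      rewrite Rpower_plus, Rpower_1 in Hb by now apply Rdiv_lt_0_compat.
      assert (Hq : spow r w = Rpower (w / x) r * spow r x).
      { rewrite !spow_pos by assumption.
        rewrite Rpower_mult_distr; [| now apply Rdiv_lt_0_compat | assumption].
        f_equal. field. lra. }
      rewrite Hq.
      apply Rle_trans with ((1 + (r + 1) * (w / x - 1)) * (x * spow r x)).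
      + right. field. lra.
      + apply Rle_trans with (Rpower (w / x) r * (w / x) * (x * spow r x)).
        * apply Rmult_le_compat_r; [| assumption]. apply Rmult_le_pos; lra.
        * right. field. lra. }
  destruct (Rtotal_order x 0) as [Hx | [-> | Hx]].
  - pose proof (Hmain (- x) (- w) ltac:(lra)) as H. rewrite !spow_opp in H. lra.
  - rewrite spow_0. lra.
  - now apply Hmain.
Qed.

(** Two tangents are chained through the midpoint [c]: the one at [x] bounds the value at [c], the
    one at [c] bounds the value at [w], and the slope at [c] differs strictly from that at [x], in
    the favourable direction. *)
Lemma spow_tangent_strict r x w : 0 < r -> w <> x ->
  x * spow r x + (r + 1) * spow r x * (w - x) < w * spow r w.
Proof.
  intros Hr Hne. set (c := (x + w) / 2).
  pose proof (spow_tangent r x c Hr) as H1. pose proof (spow_tangent r c w Hr) as H2.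
  assert (H3 : spow r x * (w - x) < spow r c * (w - x)).
  { destruct (Rtotal_order x w) as [H | [H | H]]; [| congruence |].
    - apply Rmult_lt_compat_r; [lra |]. apply spow_lt; [assumption | unfold c; lra].
    - assert (spow r c < spow r x) by (apply spow_lt; [assumption | unfold c; lra]). nra. }
  assert (Hc1 : c - x = (w - x) / 2) by (unfold c; lra).
  assert (Hc2 : w - c = (w - x) / 2) by (unfold c; lra).
  rewrite Hc1 in H1. rewrite Hc2 in H2.
  assert (H4 : (r + 1) * (spow r x * (w - x)) < (r + 1) * (spow r c * (w - x)))
    by (apply Rmult_lt_compat_l; lra).
  lra.
Qed.

Lemma spow_monotone r x w : 0 < r -> 0 <= (spow r x - spow r w) * (x - w).
Proof.
  intros Hr. destruct (Rle_lt_dec x w) as [H | H].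
  - pose proof (spow_le r x w Hr H). nra.
  - pose proof (spow_lt r w x Hr H). nra.
Qed.

Lemma spow_monotone_eq r x w : 0 < r -> (spow r x - spow r w) * (x - w) = 0 -> x = w.
Proof.
  intros Hr H0. destruct (Rtotal_order x w) as [H | [H | H]]; [| assumption |].
  - pose proof (spow_lt r x w Hr H). nra.
  - pose proof (spow_lt r w x Hr H). nra.
Qed.

Lemma rpow_lt a b r : 0 <= a -> a < b -> 0 < r -> rpow a r < rpow b r.
Proof.
  intros Ha Hab Hr. unfold rpow.
  destruct (Req_EM_T a 0), (Req_EM_T b 0); try lra.
  - apply exp_pos.
  - apply Rlt_Rpower_l; lra.
Qed.

(** * Optimality conditions: sufficiency and uniqueness *)

Lemma pnorm_le_iff p N x z : 1 < p ->
  pnorm p N x <= pnorm p N z <->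
  rsum (fun i => x i * spow (p - 1) (x i)) N <= rsum (fun i => z i * spow (p - 1) (z i)) N.
Proof.
  intros Hp. unfold pnorm.
  assert (He : forall y, rsum (fun i => rpow (Rabs (y i)) p) N = rsum (fun i => y i * spow (p - 1) (y i)) N)
    by (intros y; apply rsum_ext; intros; apply rpow_abs).
  rewrite !He.
  assert (Hnn : forall y, 0 <= rsum (fun i => y i * spow (p - 1) (y i)) N)
    by (intros y; apply rsum_nonneg; intros; apply mul_spow_nonneg).
  assert (Hp' : 0 < 1 / p) by (apply Rdiv_lt_0_compat; lra).
  split; intros H.
  - apply Rnot_lt_le. intros Hlt. apply (rpow_lt _ _ (1 / p)) in Hlt; auto. lra.
  - destruct H as [H | ->]; [| lra]. left. apply rpow_lt; auto.
Qed.

(* The optimality conditions for minimising [|x|_p] subject to [A x = y], with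
   Lagrange multiplier [nu] (rescaled by [p]). *)
Definition kkt (p : R) (m N : nat) (A : nat -> nat -> R) (y x nu : nat -> R) : Prop :=
  (forall j, (j < N)%nat -> spow (p - 1) (x j) = rsum (fun i => A i j * nu i) m) /\
  (forall i, (i < m)%nat -> mv A N x i = y i).

Lemma rsum_pairing m N (A : nat -> nat -> R) mu d :
  rsum (fun j => rsum (fun i => A i j * mu i) m * d j) N =
  rsum (fun i => mu i * mv A N d i) m.
Proof.
  unfold mv.
  rewrite (rsum_ext _ (fun j => rsum (fun i => mu i * (A i j * d j)) m)).
  - rewrite rsum_swap. apply rsum_ext. intros. now rewrite rsum_scal.
  - intros j _. rewrite Rmult_comm, <- rsum_scal. apply rsum_ext. intros. ring.
Qed.

Lemma mv_minus A N x x' i : mv A N (fun j => x j - x' j) i = mv A N x i - mv A N x' i.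
Proof.
  unfold mv. rewrite <- rsum_minus. apply rsum_ext. intros. ring.
Qed.

(** Summing the tangent inequalities at [x] over the coordinates, the linear terms add up to [p]
    times [nu . A (z - x)], which is zero for feasible [z]. A tie in the norm makes every gap
    vanish, and strictness then forces equal coordinates. *)
Lemma kkt_optimal p m N A y x nu :
  1 < p -> kkt p m N A y x nu ->
  lp_opt p m N A y x /\
  (forall x', lp_opt p m N A y x' -> forall j, (j < N)%nat -> x' j = x j).
Proof.
  intros Hp [Hx Hy].
  set (T := fun t => t * spow (p - 1) t).
  assert (Horth : forall z, (forall i, (i < m)%nat -> mv A N z i = y i) ->
    rsum (fun j => p * (spow (p - 1) (x j) * (z j - x j))) N = 0).
  { intros z Hz. rewrite rsum_scal.
    rewrite (rsum_ext _ (fun j => rsum (fun i => A i j * nu i) m * (z j - x j)))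
      by (intros; now rewrite Hx).
    rewrite (rsum_pairing m N A nu (fun j => z j - x j)), rsum_zero; [lra |].
    intros i Hi. rewrite mv_minus, Hz, Hy by assumption. lra. }
  assert (Hgap : forall z j, 0 <= T (z j) - T (x j) - p * (spow (p - 1) (x j) * (z j - x j))).
  { intros z j. pose proof (spow_tangent (p - 1) (x j) (z j) ltac:(lra)). unfold T. lra. }
  assert (Hsum : forall z, (forall i, (i < m)%nat -> mv A N z i = y i) ->
    rsum (fun j => T (z j) - T (x j) - p * (spow (p - 1) (x j) * (z j - x j))) N =
    rsum (fun j => T (z j)) N - rsum (fun j => T (x j)) N).
  { intros z Hz. rewrite 2!rsum_minus, Horth by assumption. lra. }
  split; [split; [assumption |] |].
  - intros z Hz. apply pnorm_le_iff; [assumption |].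
    pose proof (Hsum z Hz) as Hs.
    assert (0 <= rsum (fun j => T (z j) - T (x j) - p * (spow (p - 1) (x j) * (z j - x j))) N)
      by (apply rsum_nonneg; intros; apply Hgap).
    unfold T in *. lra.
  - intros x' [Hx' Hmin] j Hj. apply NNPP. intros Hne.
    specialize (Hmin x Hy). apply pnorm_le_iff in Hmin; [| assumption].
    pose proof (Hsum x' Hx') as Hs.
    assert (H0 : T (x' j) - T (x j) - p * (spow (p - 1) (x j) * (x' j - x j)) = 0).
    { apply (rsum_zero_inv (fun j => T (x' j) - T (x j) - p * (spow (p - 1) (x j) * (x' j - x j))) N);
        [intros; apply Hgap | | assumption]. unfold T in *. lra. }
    pose proof (spow_tangent_strict (p - 1) (x j) (x' j) ltac:(lra) Hne). unfold T in *. lra.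
Qed.

(** Monotonicity makes each term on the left nonnegative, so the solutions agree as soon as the
    right side vanishes. That can happen for different [y] and [y'], which is what the analysis of
    basis columns exploits. *)
Lemma kkt_pairing p m N A y x nu y' x' nu' :
  kkt p m N A y x nu -> kkt p m N A y' x' nu' ->
  rsum (fun j => (spow (p - 1) (x j) - spow (p - 1) (x' j)) * (x j - x' j)) N =
  rsum (fun i => (nu i - nu' i) * (y i - y' i)) m.
Proof.
  intros [Hx Hy] [Hx' Hy'].
  rewrite (rsum_ext _ (fun j => rsum (fun i => A i j * (nu i - nu' i)) m * (x j - x' j))).
  - rewrite (rsum_pairing m N A (fun i => nu i - nu' i) (fun j => x j - x' j)).
    apply rsum_ext. intros i Hi. now rewrite mv_minus, Hy, Hy'.
  - intros j Hj. rewrite Hx, Hx' by assumption. f_equal. rewrite <- rsum_minus.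
    apply rsum_ext. intros. ring.
Qed.

Lemma kkt_unique p m N A y x nu y' x' nu' :
  1 < p -> kkt p m N A y x nu -> kkt p m N A y' x' nu' ->
  rsum (fun i => (nu i - nu' i) * (y i - y' i)) m = 0 ->
  forall j, (j < N)%nat -> x j = x' j.
Proof.
  intros Hp H H' H0 j Hj. rewrite <- (kkt_pairing _ _ _ _ _ _ _ _ _ _ H H') in H0.
  apply (spow_monotone_eq (p - 1)); [lra |].
  apply (rsum_zero_inv (fun j => (spow (p - 1) (x j) - spow (p - 1) (x' j)) * (x j - x' j)) N);
    [| lra | assumption].
  intros. apply spow_monotone. lra.
Qed.

(* The columns [c 0, ..., c (s-1)] of [A], cut to their first [s] rows, form an
   invertible matrix. *)
Definition nonsingular (s : nat) (A : nat -> nat -> R) (c : nat -> nat) : Prop :=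
  forall mu, (forall l, (l < s)%nat -> rsum (fun i => A i (c l) * mu i) s = 0) ->
             forall i, (i < s)%nat -> mu i = 0.

(** Compactness of the unit sphere of the 1-norm. For a fixed [M] the bound is a closed condition on
    the matrix, which invertibility is not; this splits the invertible matrices into countably many
    closed families. *)
Lemma nonsingular_bound s A c : nonsingular s A c ->
  exists M : nat, forall mu,
    rsum (fun i => Rabs (mu i)) s <=
    INR M * rsum (fun l => Rabs (rsum (fun i => A i (c l) * mu i) s)) s.
Proof.
  intros Hns. apply NNPP. intros Hno.
  set (nrm := fun mu : nat -> R => rsum (fun i => Rabs (mu i)) s).
  set (img := fun mu : nat -> R => rsum (fun l => Rabs (rsum (fun i => A i (c l) * mu i) s)) s).
  assert (Himg0 : forall mu, 0 <= img mu) by (intros; apply rsum_nonneg; intros; apply Rabs_pos).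
  assert (Hc : forall k : nat, exists mu, nrm mu = 1 /\ img mu <= / INR (S k)).
  { intros k. apply NNPP. intros Hk. apply Hno. exists (S k). intros mu.
    apply Rnot_lt_le. intros Hlt. apply Hk.
    change (INR (S k) * img mu < nrm mu) in Hlt.
    assert (HSk : 0 < INR (S k)) by (apply lt_0_INR; lia).
    assert (Hpos : 0 < nrm mu) by (specialize (Himg0 mu); nra).
    assert (Hipos : 0 < / nrm mu) by now apply Rinv_0_lt_compat.
    exists (fun i => / nrm mu * mu i). split.
    - unfold nrm at 1. rewrite (rsum_ext _ (fun i => / nrm mu * Rabs (mu i))).
      + rewrite rsum_scal. change (/ nrm mu * nrm mu = 1). apply Rinv_l. lra.
      + intros. rewrite Rabs_mult, (Rabs_pos_eq (/ nrm mu)) by lra. reflexivity.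
    - unfold img. rewrite (rsum_ext _ (fun l => / nrm mu * Rabs (rsum (fun i => A i (c l) * mu i) s))).
      + rewrite rsum_scal. change (/ nrm mu * img mu <= / INR (S k)).
        apply Rmult_le_reg_l with (nrm mu); [assumption |].
        rewrite <- Rmult_assoc, Rinv_r, Rmult_1_l by lra.
        apply Rmult_le_reg_l with (INR (S k)); [assumption |].
        replace (INR (S k) * (nrm mu * / INR (S k))) with (nrm mu) by (field; lra). lra.
      + intros l _. rewrite (rsum_ext _ (fun i => / nrm mu * (A i (c l) * mu i))) by (intros; ring).
        rewrite rsum_scal, Rabs_mult, (Rabs_pos_eq (/ nrm mu)) by lra. reflexivity. }
  apply functional_choice in Hc. destruct Hc as [u Hu].
  destruct (bolzano_weierstrass s u 1) as (phi & v & Hphi & Hv).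
  { intros k i Hi. destruct (Hu k) as [H1 _]. rewrite <- H1.
    apply (rsum_term_le (fun i => Rabs (u k i))); [intros; apply Rabs_pos | assumption]. }
  assert (Hn : scont s nrm).
  { apply scont_rsum. intros. apply scont_abs, scont_coord. assumption. }
  assert (Hi : scont s img).
  { apply scont_rsum. intros. apply scont_abs, scont_rsum. intros.
    apply scont_mult; [apply scont_const | now apply scont_coord]. }
  assert (H1 : nrm v = 1).
  { apply (UL_sequence (fun k => nrm (u (phi k)))); [now apply Hn |].
    apply Un_cv_eq with (fun _ => 1); [| apply Un_cv_const]. intros k. symmetry. apply Hu. }
  assert (H0 : img v <= 0).
  { apply (Un_cv_le (fun k => img (u (phi k))) (fun k => / INR (S (phi k)))).
    - intros. apply Hu.
    - now apply Hi.
    - apply (Un_cv_subseq (fun k => / INR (S k)) 0 phi Hphi). apply Un_cv_inv_S.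
      intros k. rewrite Rminus_0_r. rewrite Rabs_pos_eq; [lra |].
      left. apply Rinv_0_lt_compat, lt_0_INR. lia. }
  assert (Hz : forall i, (i < s)%nat -> v i = 0).
  { apply Hns. intros l Hl. apply Rabs_zero_inv.
    apply (rsum_zero_inv (fun l => Rabs (rsum (fun i => A i (c l) * v i) s)) s); auto.
    intros; apply Rabs_pos. }
  unfold nrm in H1. rewrite rsum_zero in H1; [lra |].
  intros i Hi'. rewrite Hz by assumption. apply Rabs_R0.
Qed.

(** * Existence of a multiplier *)

Lemma coercive_min D G C :
  scont D G -> (forall v, rsum (fun i => Rabs (v i)) D - C <= G v) ->
  exists v, forall w, G v <= G w.
Proof.
  intros HG HC.
  assert (HC' : forall v, - C <= G v).
  { intros v. specialize (HC v). assert (0 <= rsum (fun i => Rabs (v i)) D) by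
      (apply rsum_nonneg; intros; apply Rabs_pos). lra. }
  destruct (completeness (fun t => exists v, t = - G v)) as [g [Hub Hlub]].
  - exists C. intros t [v ->]. specialize (HC' v). lra.
  - now exists (- G (fun _ => 0)), (fun _ => 0).
  - assert (Hlow : forall v, - g <= G v).
    { intros v. assert (- G v <= g) by (apply Hub; now exists v). lra. }
    assert (Hc : forall k : nat, exists v, G v <= - g + / INR (S k)).
    { intros k. assert (Hk : 0 < / INR (S k)) by (apply Rinv_0_lt_compat, lt_0_INR; lia).
      apply NNPP. intros Hno. assert (g <= g - / INR (S k)); [| lra].
      apply Hlub. intros t [v ->]. apply Rnot_lt_le. intros Hlt. apply Hno. exists v. lra. }
    apply functional_choice in Hc. destruct Hc as [u Hu].
    destruct (bolzano_weierstrass D u (- g + 1 + C)) as (phi & v & Hphi & Hv).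
    { intros k i Hi. specialize (HC (u k)). specialize (Hu k).
      assert (/ INR (S k) <= 1).
      { rewrite <- Rinv_1. apply Rinv_le_contravar; [lra |]. apply (le_INR 1). lia. }
      pose proof (rsum_term_le (fun i => Rabs (u k i)) D i ltac:(intros; apply Rabs_pos) Hi).
      simpl in H0. lra. }
    exists v. intros w. apply Rle_trans with (- g); [| apply Hlow].
    apply (Un_cv_le (fun k => G (u (phi k))) (fun k => - g + / INR (S (phi k)))).
    + intros. apply Hu.
    + now apply HG.
    + rewrite <- (Rplus_0_r (- g)) at 1.
      apply (CV_plus (fun _ => - g) (fun k => / INR (S (phi k)))); [apply Un_cv_const |].
      apply (Un_cv_subseq (fun k => / INR (S k)) 0 phi Hphi). apply Un_cv_inv_S.
      intros k. rewrite Rminus_0_r. rewrite Rabs_pos_eq; [lra |].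
      left. apply Rinv_0_lt_compat, lt_0_INR. lia.
Qed.

Lemma sum_injective_le (c : nat -> nat) s N (f : nat -> R) :
  (forall l, (l < s)%nat -> (c l < N)%nat) ->
  (forall l l', (l < s)%nat -> (l' < s)%nat -> c l = c l' -> l = l') ->
  (forall j, 0 <= f j) -> rsum (fun l => f (c l)) s <= rsum f N.
Proof.
  intros Hc Hinj Hf. change (rsum f N) with (lsum f (seq 0 N)).
  replace (rsum (fun l => f (c l)) s) with (lsum f (map c (seq 0 s)))
    by (unfold lsum, rsum; now rewrite map_map).
  apply lsum_incl; [assumption | |].
  - clear Hc. assert (Hs : forall l, In l (seq 0 s) -> (l < s)%nat) by (intros l Hl; apply in_seq in Hl; lia).
    pose proof (seq_NoDup s 0) as Hn. induction Hn as [| a l Ha Hn IH]; [constructor |].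
    simpl. constructor.
    + intros Hin. apply in_map_iff in Hin. destruct Hin as [b [Hb Hin]].
      apply Hinj in Hb; [subst; contradiction | |]; apply Hs; simpl; auto.
    + apply IH. intros; apply Hs; now right.
  - intros j Hj. apply in_map_iff in Hj. destruct Hj as [l [<- Hl]].
    apply in_seq in Hl. apply in_seq. specialize (Hc l). lia.
Qed.

(* The multiplier minimises the dual objective
   [sum_j |a_j . nu|^q / q - y . nu], where [1/p + 1/q = 1]. *)
Lemma kkt_exists p m N A y c :
  1 < p -> nonsingular m A c ->
  (forall l, (l < m)%nat -> (c l < N)%nat) ->
  (forall l l', (l < m)%nat -> (l' < m)%nat -> c l = c l' -> l = l') ->
  exists x nu, kkt p m N A y x nu.
Proof.
  intros Hp Hns Hc Hinj. set (r := / (p - 1)).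
  assert (Hr : 0 < r) by (apply Rinv_0_lt_compat; lra).
  destruct (nonsingular_bound m A c Hns) as [M HM].
  set (dot := fun nu j => rsum (fun i => A i j * nu i) m).
  set (Y := rsum (fun i => Rabs (y i)) m).
  set (G := fun nu => rsum (fun j => dot nu j * spow r (dot nu j)) N * / (r + 1) - rsum (fun i => y i * nu i) m).
  assert (HG : scont m G).
  { unfold G, dot.
    assert (Hdot : forall j, scont m (fun nu => rsum (fun i => A i j * nu i) m)).
    { intros j. apply scont_rsum. intros. apply scont_mult; [apply scont_const | now apply scont_coord]. }
    apply scont_minus.
    - apply scont_mult; [| apply scont_const]. apply scont_rsum. intros.
      apply scont_mult; [apply Hdot | apply scont_spow; [assumption | apply Hdot]].
    - apply scont_rsum. intros. apply scont_mult; [apply scont_const | now apply scont_coord]. }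
  assert (HY : 0 <= Y) by (apply rsum_nonneg; intros; apply Rabs_pos).
  (* With this slope, [B] times the sum of the [|a_j . v|] is at least [(Y + 1) |v|_1]. The term
     [y . v] absorbs at most [Y |v|_1], and the [|v|_1] left over gives coercivity. *)
  set (B := (Y + 1) * INR (S M)).
  assert (HSM : 0 < INR (S M)) by (apply lt_0_INR; lia).
  assert (HB : 0 < B) by (apply Rmult_lt_0_compat; lra).
  (* The point where [|t|^(r+1) / (r+1)] has slope [B]; its tangent there yields [Hlin]. *)
  set (b := spow (/ r) B).
  assert (Hb : spow r b = B) by (apply spow_inv'; lra).
  assert (Hlin : forall t, B * Rabs t - B * b <= t * spow r t * / (r + 1)).
  { intros t. assert (Hb0 : 0 < b) by (apply spow_gt0; assumption).
    assert (Ht : b * B + (r + 1) * B * (Rabs t - b) <= t * spow r t).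
    { pose proof (spow_tangent r b (Rabs t) Hr) as Ht. rewrite Hb in Ht.
      replace (t * spow r t) with (Rabs t * spow r (Rabs t)); [assumption |].
      unfold Rabs. destruct (Rcase_abs t); [rewrite spow_opp |]; ring. }
    apply Rmult_le_reg_r with (r + 1); [lra |].
    rewrite (Rmult_assoc (t * spow r t)), Rinv_l by lra. nra. }
  destruct (coercive_min m G (INR N * (B * b)) HG) as [nu Hnu].
  { intros v. unfold G.
    assert (H1 : B * rsum (fun j => Rabs (dot v j)) N - INR N * (B * b)
      <= rsum (fun j => dot v j * spow r (dot v j)) N * / (r + 1)).
    { rewrite <- rsum_const, <- rsum_scal, <- rsum_minus, (Rmult_comm _ (/ (r + 1))), <- rsum_scal.
      apply rsum_le. intros j _. rewrite (Rmult_comm (/ (r + 1))). apply Hlin. }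
    pose proof (sum_injective_le c m N (fun j => Rabs (dot v j)) Hc Hinj ltac:(intros; apply Rabs_pos)) as H2.
    simpl in H2. specialize (HM v). change (fun l => Rabs (rsum (fun i => A i (c l) * v i) m)) with (fun l => Rabs (dot v (c l))) in HM.
    assert (Hn0 : 0 <= rsum (fun l => Rabs (dot v (c l))) m) by (apply rsum_nonneg; intros; apply Rabs_pos).
    assert (H3 : rsum (fun i => y i * v i) m <= Y * rsum (fun i => Rabs (v i)) m).
    { rewrite <- rsum_scal. apply rsum_le. intros i Hi.
      apply Rle_trans with (Rabs (y i * v i)); [apply Rle_abs |]. rewrite Rabs_mult.
      apply Rmult_le_compat_r; [apply Rabs_pos |].
      apply (rsum_term_le (fun i => Rabs (y i))); [intros; apply Rabs_pos | assumption]. }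
    set (sv := rsum (fun i => Rabs (v i)) m) in *.
    set (sd := rsum (fun j => Rabs (dot v j)) N) in *.
    assert (H4 : sv <= INR (S M) * sd).
    { eapply Rle_trans; [exact HM |]. apply Rmult_le_compat; [apply pos_INR | assumption | | assumption].
      apply le_INR. lia. }
    assert (H5 : (Y + 1) * sv <= B * sd) by (unfold B; rewrite Rmult_assoc; apply Rmult_le_compat_l; lra).
    lra. }
  exists (fun j => spow r (dot nu j)), nu. split.
  - intros j Hj. unfold r. apply spow_inv'. lra.
  - intros i Hi.
    set (e := fun i' : nat => if (i' =? i)%nat then 1 else 0).
    assert (Hsingle : forall f : nat -> R, rsum (fun i' => f i' * e i') m = f i).
    { intros f. rewrite (rsum_single _ m i); [| assumption |].
      - unfold e. rewrite Nat.eqb_refl. ring.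
      - intros i' _ Hne. unfold e. apply Nat.eqb_neq in Hne. rewrite Hne. ring. }
    (* [g t] is the partial derivative of the dual objective [G] along [e] at [nu + t e]. The
       tangent inequality at that point, read at [nu], together with the minimality of [nu], gives
       [0 <= t * g t]; letting [t] tend to 0 from both sides yields [g 0 = 0] without
       differentiating. *)
    set (g := fun t => mv A N (fun j => spow r (dot nu j + t * A i j)) i - y i).
    assert (Hg : forall t, 0 <= t * g t).
    { intros t. specialize (Hnu (fun i' => nu i' + t * e i')).
      assert (Hdot : forall j, dot (fun i' => nu i' + t * e i') j = dot nu j + t * A i j).
      { intros j. unfold dot. rewrite <- (Hsingle (fun i' => A i' j)), <- rsum_scal, <- rsum_plus.
        apply rsum_ext. intros. ring. }
      assert (Hyy : rsum (fun i' => y i' * (nu i' + t * e i')) m = rsum (fun i' => y i' * nu i') m + t * y i).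
      { rewrite <- (Hsingle y), <- rsum_scal, <- rsum_plus. apply rsum_ext. intros. ring. }
      unfold G in Hnu. rewrite Hyy in Hnu.
      rewrite (rsum_ext (fun j => dot (fun i' => nu i' + t * e i') j * spow r (dot (fun i' => nu i' + t * e i') j))
        (fun j => (dot nu j + t * A i j) * spow r (dot nu j + t * A i j))) in Hnu
        by (intros; now rewrite Hdot).
      assert (Hle : rsum (fun j => (dot nu j + t * A i j) * spow r (dot nu j + t * A i j)) N
        - rsum (fun j => dot nu j * spow r (dot nu j)) N
        <= (r + 1) * (t * mv A N (fun j => spow r (dot nu j + t * A i j)) i)).
      { unfold mv. rewrite <- rsum_minus, <- rsum_scal, <- rsum_scal. apply rsum_le.
        intros j _. pose proof (spow_tangent r (dot nu j + t * A i j) (dot nu j) Hr). lra. }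
      apply (Rmult_le_compat_r (/ (r + 1))) in Hle; [| left; apply Rinv_0_lt_compat; lra].
      replace ((r + 1) * (t * mv A N (fun j => spow r (dot nu j + t * A i j)) i) * / (r + 1))
        with (t * mv A N (fun j => spow r (dot nu j + t * A i j)) i) in Hle by (field; lra).
      unfold g. lra. }
    assert (Hgc : forall u, Un_cv u 0 -> Un_cv (fun k => g (u k)) (g 0)).
    { intros u Hu.
      assert (Hs : scont 1 (fun w => g (w O))).
      { unfold g, mv. apply scont_minus; [| apply scont_const]. apply scont_rsum. intros j _.
        apply scont_mult; [apply scont_const |]. apply scont_spow; [assumption |].
        apply scont_plus; [apply scont_const |]. apply scont_mult; [| apply scont_const].
        apply scont_coord. lia. }
      apply (Hs (fun k _ => u k) (fun _ => 0)). intros i' _. exact Hu. }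
    assert (Hinv : forall k, 0 < / INR (S k)) by (intros k; apply Rinv_0_lt_compat, lt_0_INR; lia).
    assert (Hcv : Un_cv (fun k => / INR (S k)) 0).
    { apply Un_cv_inv_S. intros k. rewrite Rminus_0_r, Rabs_pos_eq; [lra |]. now left. }
    assert (Hcv' : Un_cv (fun k => - / INR (S k)) 0).
    { apply Un_cv_inv_S. intros k. rewrite Rminus_0_r, Rabs_Ropp, Rabs_pos_eq; [lra |]. now left. }
    assert (Hge : 0 <= g 0).
    { apply (Un_cv_le (fun _ => 0) (fun k => g (/ INR (S k)))); [| apply Un_cv_const | now apply Hgc].
      intros k. specialize (Hg (/ INR (S k))). specialize (Hinv k). nra. }
    assert (Hle : g 0 <= 0).
    { apply (Un_cv_le (fun k => g (- / INR (S k))) (fun _ => 0)); [| now apply Hgc | apply Un_cv_const].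
      intros k. specialize (Hg (- / INR (S k))). specialize (Hinv k). nra. }
    assert (H0 : g 0 = 0) by lra. unfold g, mv in H0. unfold mv.
    rewrite (rsum_ext _ (fun j => A i j * spow r (dot nu j + 0 * A i j))); [lra |].
    intros. do 2 f_equal. lra.
Qed.

(** * Exceptional matrices and right-hand sides *)

Lemma join_l n a z i : (i < n)%nat -> join n a z i = a i.
Proof. intros H. unfold join. destruct (Nat.ltb_spec i n); [reflexivity | lia]. Qed.

Lemma join_r n a z i : join n a z (n + i) = z i.
Proof. unfold join. destruct (Nat.ltb_spec (n + i) n); [lia |]. f_equal. lia. Qed.

Lemma finite_bound D (w : nat -> R) :
  exists M : nat, forall i, (i < D)%nat -> Rabs (w i) <= INR M.
Proof.
  destruct (INR_unbounded (rsum (fun i => Rabs (w i)) D)) as [M HM].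
  exists M. intros i Hi.
  pose proof (rsum_term_le (fun i => Rabs (w i)) D i ltac:(intros; apply Rabs_pos) Hi).
  simpl in H. lra.
Qed.

Lemma flat_lt m N i j : (i < m)%nat -> (j < N)%nat -> (i * N + j < m * N)%nat.
Proof. intros. nia. Qed.

Lemma flat_inj N i j i' j' :
  (j < N)%nat -> (j' < N)%nat -> (i * N + j = i' * N + j')%nat -> i = i' /\ j = j'.
Proof.
  intros Hj Hj' H. destruct (Nat.lt_total i i') as [Hi | [-> | Hi]]; nia.
Qed.

(** Induction on the block size replaces determinants. If the block of size [s] is invertible and
    the next one is not, a left kernel vector has a nonzero last entry, scaled to 1. Its other
    entries are determined by the first [s] columns, and the last column then determines the corner
    entry from the remaining ones. *)
Lemma nonsingular_ae m N s c :
  (0 < m)%nat -> (0 < N)%nat -> (s <= m)%nat ->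
  (forall l, (l < s)%nat -> (c l < N)%nat) ->
  (forall l l', (l < s)%nat -> (l' < s)%nat -> c l = c l' -> l = l') ->
  matnull m N (fun A => ~ nonsingular s A c).
Proof.
  intros Hm HN. unfold matnull.
  assert (HmN : (0 < m * N)%nat) by nia.
  induction s; intros Hs Hc Hinj.
  - apply nullset_empty; [assumption |]. intros v Hv. apply Hv. intros mu _ i Hi. lia.
  - set (A := fun (w : nat -> R) i j => w (i * N + j)%nat).
    set (mu := fun (w : nat -> R) i => w (m * N + i)%nat).
    (* The kernel vector is stored behind the [m * N] matrix entries; the last clause records the
       invertibility of the smaller block in closed form. *)
    set (Phi := fun (M : nat) w =>
      (forall l, (l < S s)%nat -> rsum (fun i => A w i (c l) * mu w i) (S s) = 0) /\
      mu w s = 1 /\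
      (forall nu : nat -> R, rsum (fun i => Rabs (nu i)) s <=
        INR M * rsum (fun l => Rabs (rsum (fun i => A w i (c l) * nu i) s)) s)).
    set (C := fun M x => exists w, Phi M w /\
      (forall i, (i < m * N + S s)%nat -> Rabs (w i) <= INR M) /\
      (forall i, (i < m * N)%nat -> x i = w i)).
    apply nullset_subset with (fun v => ~ nonsingular s (A v) c \/ exists M, C M v).
    + intros v Hv. change (~ nonsingular (S s) (A v) c) in Hv.
      destruct (classic (nonsingular s (A v) c)) as [Hns | Hns]; [right | now left].
      assert (Hnu : exists nu, (forall l, (l < S s)%nat -> rsum (fun i => A v i (c l) * nu i) (S s) = 0)
        /\ nu s <> 0).
      { apply NNPP. intros Hno. apply Hv. intros nu Hnu.
        assert (H0 : nu s = 0) by (apply NNPP; intros Hne; apply Hno; now exists nu).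
        intros i Hi. destruct (Nat.eq_dec i s) as [-> | Hne]; [assumption |].
        apply (Hns nu); [| lia]. intros l Hl. specialize (Hnu l ltac:(lia)).
        rewrite rsum_S, H0 in Hnu. lra. }
      destruct Hnu as (nu & Hnu & Hnus).
      destruct (nonsingular_bound s (A v) c Hns) as [M1 HM1].
      set (w := join (m * N) v (fun i => / nu s * nu i)).
      destruct (finite_bound (m * N + S s) w) as [M2 HM2].
      assert (HAw : forall i l, (i < S s)%nat -> (l < S s)%nat -> A w i (c l) = A v i (c l)).
      { intros i l Hi Hl. unfold A, w. rewrite join_l; [reflexivity |].
        apply flat_lt; [lia | now apply Hc]. }
      exists (M1 + M2)%nat, w. split; [split; [| split] | split].
      * intros l Hl. rewrite (rsum_ext _ (fun i => / nu s * (A v i (c l) * nu i))).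
        -- rewrite rsum_scal, Hnu by assumption. ring.
        -- intros i Hi. rewrite HAw by assumption. unfold mu, w. rewrite join_r. ring.
      * unfold mu, w. rewrite join_r. now apply Rinv_l.
      * intros nu'.
        rewrite (rsum_ext (fun l => Rabs (rsum (fun i => A w i (c l) * nu' i) s))
          (fun l => Rabs (rsum (fun i => A v i (c l) * nu' i) s))).
        -- eapply Rle_trans; [apply HM1 |]. apply Rmult_le_compat_r.
           ++ apply rsum_nonneg. intros. apply Rabs_pos.
           ++ apply le_INR. lia.
        -- intros l Hl. f_equal. apply rsum_ext. intros i Hi. rewrite HAw by lia. reflexivity.
      * intros i Hi. eapply Rle_trans; [now apply HM2 |]. apply le_INR. lia.
      * intros i Hi. symmetry. now apply join_l.
    + apply nullset_or; [apply IHs; auto; lia |].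
      apply nullset_union. intros M. apply content_zero_nullset; [assumption |].
      assert (HscA : forall i l, (i < S s)%nat -> (l < S s)%nat ->
        scont (m * N + S s) (fun w => A w i (c l))).
      { intros i l Hi Hl. apply scont_coord.
        pose proof (flat_lt m N i (c l) ltac:(lia) (Hc l Hl)). lia. }
      apply graph_content_zero with (i0 := (s * N + c s)%nat); [apply flat_lt; auto; lia | lia | |].
      * apply sclosed_and; [| apply sclosed_and].
        -- apply sclosed_forall. intros l. apply sclosed_imp. intros Hl.
           apply sclosed_eq; [| apply scont_const]. apply scont_rsum. intros i Hi.
           apply scont_mult; [now apply HscA | apply scont_coord; lia].
        -- apply sclosed_eq; [apply scont_coord; lia | apply scont_const].
        -- apply sclosed_forall. intros nu. apply sclosed_le; [apply scont_const |].
           apply scont_mult; [apply scont_const |]. apply scont_rsum. intros l Hl.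
           apply scont_abs, scont_rsum. intros i Hi.
           apply scont_mult; [apply HscA; lia | apply scont_const].
      * intros w w' (H1 & H2 & H3) (H1' & H2' & H3') Heq.
        assert (HA : forall i l, (i < S s)%nat -> (l < S s)%nat -> (i, l) <> (s, s) ->
          A w i (c l) = A w' i (c l)).
        { intros i l Hi Hl Hne. apply Heq.
          - apply flat_lt; [lia | now apply Hc].
          - intros H. apply flat_inj in H; [| apply Hc; lia | apply Hc; lia].
            destruct H as [-> H]. apply Hinj in H; [congruence | lia | lia]. }
        assert (Hmu : forall i, (i < s)%nat -> mu w i = mu w' i).
        { intros i Hi. apply Rminus_diag_uniq. apply Rabs_zero_inv.
          apply (rsum_zero_inv (fun i => Rabs (mu w i - mu w' i)) s); [intros; apply Rabs_pos | | assumption].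
          eapply Rle_trans; [apply H3 |]. rewrite rsum_zero; [lra |].
          intros l Hl. rewrite (rsum_ext _ (fun i => A w i (c l) * mu w i - A w' i (c l) * mu w' i)).
          - rewrite rsum_minus. specialize (H1 l ltac:(lia)). specialize (H1' l ltac:(lia)).
            rewrite rsum_S, H2 in H1. rewrite rsum_S, H2' in H1'.
            rewrite (HA s l) in H1 by (try lia; intros [=]; lia).
            replace (_ - _) with 0 by lra. apply Rabs_R0.
          - intros i' Hi'. rewrite (HA i' l) by (try lia; intros [=]; lia). ring. }
        specialize (H1 s ltac:(lia)). specialize (H1' s ltac:(lia)).
        rewrite rsum_S, H2 in H1. rewrite rsum_S, H2' in H1'.
        rewrite (rsum_ext _ (fun i => A w' i (c s) * mu w' i)) in H1.
        -- unfold A in *. lra.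
        -- intros i Hi. rewrite Hmu by assumption. rewrite (HA i s) by (try lia; intros [=]; lia).
           reflexivity.
Qed.

Lemma kkt_ext p m N A A' y y' x x' nu nu' :
  (forall i j, (i < m)%nat -> (j < N)%nat -> A i j = A' i j) ->
  (forall i, (i < m)%nat -> y i = y' i) ->
  (forall j, (j < N)%nat -> x j = x' j) ->
  (forall i, (i < m)%nat -> nu i = nu' i) ->
  kkt p m N A y x nu -> kkt p m N A' y' x' nu'.
Proof.
  intros HA Hy Hx Hnu [H1 H2]. split.
  - intros j Hj. rewrite <- Hx, H1 by assumption. apply rsum_ext. intros i Hi.
    now rewrite HA, Hnu.
  - intros i Hi. rewrite <- Hy, <- H2 by assumption. apply rsum_ext. intros j Hj.
    now rewrite HA, Hx.
Qed.

(** Where [x j0] vanishes, column [j0] contributes nothing to [A x], and its stationarity equation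
    survives as [0 = 0]. Systems that differ only in that column thus become comparable. *)
Lemma kkt_erase_column p m N A y x nu j0 :
  kkt p m N A y x nu -> x j0 = 0 ->
  kkt p m N (fun i j => if (j =? j0)%nat then 0 else A i j) y x nu.
Proof.
  intros [H1 H2] H0. split.
  - intros j Hj. destruct (Nat.eqb_spec j j0) as [-> | Hne].
    + rewrite H0, spow_0, rsum_zero; [reflexivity |]. intros. ring.
    + now apply H1.
  - intros i Hi. rewrite <- H2 by assumption. apply rsum_ext. intros j Hj.
    destruct (Nat.eqb_spec j j0) as [-> | Hne]; [rewrite H0; ring | reflexivity].
Qed.

Lemma sclosed_kkt p m N D A y x nu :
  1 < p ->
  (forall i j, (i < m)%nat -> (j < N)%nat -> scont D (A i j)) ->
  (forall i, (i < m)%nat -> scont D (y i)) ->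
  (forall j, (j < N)%nat -> scont D (x j)) ->
  (forall i, (i < m)%nat -> scont D (nu i)) ->
  sclosed D (fun w => kkt p m N (fun i j => A i j w) (fun i => y i w) (fun j => x j w) (fun i => nu i w)).
Proof.
  intros Hp HA Hy Hx Hnu. apply sclosed_and.
  - apply sclosed_forall. intros j. apply sclosed_imp. intros Hj. apply sclosed_eq.
    + apply scont_spow; [lra | auto].
    + apply scont_rsum. intros. apply scont_mult; auto.
  - apply sclosed_forall. intros i. apply sclosed_imp. intros Hi. apply sclosed_eq; [| auto].
    apply scont_rsum. intros. apply scont_mult; auto.
Qed.

(** * Right-hand sides with a vanishing solution coordinate *)

Definition independent (m k : nat) (B : nat -> nat -> R) : Prop :=
  forall z, (forall i, (i < m)%nat -> mv B k z i = 0) -> forall l, (l < k)%nat -> z l = 0.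

(** Along a [z l0]-line, [y - y'] is a multiple of the column [a] at [sg l0]. If both solutions
    vanish there, [a . nu = a . nu' = 0], so the pairing is zero and [x = x']; then [y = y'], and
    independence gives [z = z']. *)
Lemma zero_at_used_column_null p m N A k sg l0 :
  1 < p -> (l0 < k)%nat -> (sg l0 < N)%nat ->
  independent m k (fun i l => A i (sg l)) ->
  nullset k (fun z => exists x nu,
    kkt p m N A (mv (fun i l => A i (sg l)) k z) x nu /\ x (sg l0) = 0).
Proof.
  intros Hp Hl0 HsN Hind. set (B := fun i l => A i (sg l)).
  set (Phi := fun w : nat -> R =>
    kkt p m N A (mv B k w) (fun j => w (k + j)%nat) (fun i => w (k + (N + i))%nat) /\
    w (k + sg l0)%nat = 0).
  set (C := fun M z => exists w, Phi w /\
    (forall i, (i < k + (N + m))%nat -> Rabs (w i) <= INR M) /\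
    (forall i, (i < k)%nat -> z i = w i)).
  apply nullset_subset with (fun z => exists M, C M z).
  - intros z (x & nu & Hk & H0). set (w := join k z (join N x nu)).
    destruct (finite_bound (k + (N + m)) w) as [M HM].
    exists M, w. split; [split | split; [assumption |]].
    + eapply kkt_ext; [| | | | exact Hk].
      * reflexivity.
      * intros i Hi. apply rsum_ext. intros l Hl. unfold w. now rewrite join_l.
      * intros j Hj. unfold w. now rewrite join_r, join_l.
      * intros i Hi. unfold w. now rewrite !join_r.
    + unfold w. now rewrite join_r, join_l.
    + intros i Hi. symmetry. now apply join_l.
  - apply nullset_union. intros M. apply content_zero_nullset; [lia |].
    apply graph_content_zero with l0; [assumption | lia | |].
    + apply sclosed_and; [| apply sclosed_eq; [apply scont_coord; lia | apply scont_const]].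
      apply (sclosed_kkt p m N (k + (N + m)) (fun i j _ => A i j) (fun i w => mv B k w i)
        (fun j w => w (k + j)%nat) (fun i w => w (k + (N + i))%nat)); [assumption | | | |].
      * intros. apply scont_const.
      * intros. apply scont_rsum. intros. apply scont_mult; [apply scont_const | apply scont_coord; lia].
      * intros. apply scont_coord. lia.
      * intros. apply scont_coord. lia.
    + intros w w' [Hk H0] [Hk' H0'] Heq.
      assert (Hy : forall i, mv B k w i - mv B k w' i = A i (sg l0) * (w l0 - w' l0)).
      { intros i. rewrite <- mv_minus. apply (rsum_single (fun l => B i l * (w l - w' l)) k l0 Hl0).
        intros l Hl Hne. rewrite (Heq l Hl Hne). ring. }
      assert (Hx : forall j, (j < N)%nat -> w (k + j)%nat = w' (k + j)%nat).
      { apply (kkt_unique _ _ _ _ _ _ _ _ _ _ Hp Hk Hk').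
        pose proof (proj1 Hk (sg l0) HsN) as Hs. pose proof (proj1 Hk' (sg l0) HsN) as Hs'.
        simpl in Hs, Hs'. rewrite H0, spow_0 in Hs. rewrite H0', spow_0 in Hs'.
        rewrite (rsum_ext _ (fun i => (w l0 - w' l0) *
          (A i (sg l0) * w (k + (N + i))%nat - A i (sg l0) * w' (k + (N + i))%nat)))
          by (intros; rewrite Hy; ring).
        rewrite rsum_scal, rsum_minus, <- Hs, <- Hs'. ring. }
      apply Rminus_diag_uniq. apply (Hind (fun l => w l - w' l)); [| assumption].
      intros i Hi. fold B. rewrite mv_minus.
      rewrite <- (proj2 Hk i Hi), <- (proj2 Hk' i Hi). unfold mv.
      rewrite (rsum_ext _ (fun j => A i j * w' (k + j)%nat)); [ring |].
      intros j Hj. now rewrite Hx.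
Qed.

(** The columns [sg l] that generate [y] and the columns [c l] that determine [nu] all avoid [j0].
    Hence moving the single entry at [(i0, j0)] changes neither [y], [x] nor [nu], while
    [a_j0 . nu = 0] allows at most one value for it. *)
Lemma zero_at_unused_column_null p m N k sg c i0 j0 :
  1 < p -> (0 < k)%nat -> (i0 < m)%nat -> (j0 < N)%nat ->
  (forall l, (l < k)%nat -> (sg l < N)%nat /\ sg l <> j0) ->
  (forall l, (l < m)%nat -> (c l < N)%nat /\ c l <> j0) ->
  matnull m N (fun A => nonsingular m A c /\
    ~ nullset k (fun z => exists x nu,
        kkt p m N A (mv (fun i l => A i (sg l)) k z) x nu /\ x j0 = 0 /\ nu i0 <> 0)).
Proof.
  intros Hp Hk Hi0 Hj0 Hsg Hc. unfold matnull.
  set (A := fun (w : nat -> R) i j => w (i * N + j)%nat).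
  set (y := fun w i => mv (fun i l => A w i (sg l)) k (fun l => w (m * N + l)%nat) i).
  set (x := fun (w : nat -> R) j => w (m * N + (k + j))%nat).
  set (nu := fun (w : nat -> R) i => w (m * N + (k + (N + i)))%nat).
  set (D := (m * N + (k + (N + m)))%nat).
  set (Phi := fun (M : nat) w =>
    kkt p m N (A w) (y w) (x w) (nu w) /\ x w j0 = 0 /\ 1 <= INR M * Rabs (nu w i0) /\
    (forall mu : nat -> R, rsum (fun i => Rabs (mu i)) m <=
        INR M * rsum (fun l => Rabs (rsum (fun i => A w i (c l) * mu i) m)) m)).
  set (C := fun M v => exists w, Phi M w /\
    (forall i, (i < D)%nat -> Rabs (w i) <= INR M) /\
    (forall i, (i < m * N + k)%nat -> v i = w i)).
  (* If all the slices at [a] were null, so would be their union over [M], which contains the bad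
     parameters; a bad matrix therefore has a slice that is not null for some [M]. *)
  apply nullset_subset with
    (fun a => exists M, ~ nullset k (fun z => C M (join (m * N) a z))).
  - intros a [Hns Hbad]. apply NNPP. intros Hno. apply Hbad.
    apply nullset_subset with (fun z => exists M, C M (join (m * N) a z)).
    + intros z (x' & nu' & Hkkt & Hx0 & Hnu0).
      destruct (nonsingular_bound m (A a) c Hns) as [M1 HM1].
      set (w := join (m * N) a (join k z (join N x' nu'))).
      destruct (finite_bound D w) as [M2 HM2].
      destruct (INR_unbounded (/ Rabs (nu' i0))) as [M3 HM3].
      assert (Hnpos : 0 < Rabs (nu' i0)) by now apply Rabs_pos_lt.
      assert (HA : forall i j, (i < m)%nat -> (j < N)%nat -> A w i j = A a i j)
        by (intros; unfold A, w; rewrite join_l; [reflexivity | now apply flat_lt]).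
      exists (M1 + M2 + M3)%nat, w. split; [split; [| split; [| split]] | split].
      * eapply kkt_ext; [| | | | exact Hkkt].
        -- intros i j Hi Hj. symmetry. now apply HA.
        -- intros i Hi. apply rsum_ext. intros l Hl. rewrite HA by (auto; now apply Hsg).
           unfold w. now rewrite join_r, join_l.
        -- intros j Hj. unfold x, w. now rewrite !join_r, join_l.
        -- intros i Hi. unfold nu, w. now rewrite !join_r.
      * unfold x, w. now rewrite !join_r, join_l.
      * unfold nu, w. rewrite !join_r. rewrite <- (Rinv_l (Rabs (nu' i0))) by lra.
        apply Rmult_le_compat_r; [lra |]. rewrite !plus_INR.
        pose proof (pos_INR M1). pose proof (pos_INR M2). lra.
      * intros mu.
        rewrite (rsum_ext (fun l => Rabs (rsum (fun i => A w i (c l) * mu i) m))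
          (fun l => Rabs (rsum (fun i => A a i (c l) * mu i) m))).
        -- eapply Rle_trans; [apply HM1 |]. apply Rmult_le_compat_r.
           ++ apply rsum_nonneg. intros. apply Rabs_pos.
           ++ apply le_INR. lia.
        -- intros l Hl. f_equal. apply rsum_ext. intros i Hi.
           rewrite HA by (auto; now apply Hc). reflexivity.
      * intros i Hi. eapply Rle_trans; [now apply HM2 |]. apply le_INR. lia.
      * intros i Hi. unfold w. destruct (Nat.lt_ge_cases i (m * N)) as [Hlt | Hge].
        -- now rewrite !join_l.
        -- replace i with (m * N + (i - m * N))%nat by lia. rewrite !join_r, join_l by lia.
           reflexivity.
    + apply nullset_union. intros M. apply NNPP. intros HM. apply Hno. now exists M.
  - apply nullset_union. intros M. apply nullset_sections; [nia | assumption |].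
    assert (HscA : forall i j, (i < m)%nat -> (j < N)%nat -> scont D (fun w => A w i j)).
    { intros i j Hi Hj. apply scont_coord. pose proof (flat_lt m N i j Hi Hj). unfold D. lia. }
    pose proof (flat_lt m N i0 j0 Hi0 Hj0) as Hflat.
    apply graph_content_zero with (i0 := (i0 * N + j0)%nat); [lia | unfold D; lia | |].
    + apply sclosed_and; [| apply sclosed_and; [| apply sclosed_and]].
      * apply (sclosed_kkt p m N D (fun i j w => A w i j) (fun i w => y w i)
          (fun j w => x w j) (fun i w => nu w i)); [assumption | assumption | | |].
        -- intros i Hi. apply scont_rsum. intros l Hl.
           apply scont_mult; [apply HscA; [assumption | now apply Hsg] | apply scont_coord; unfold D; lia].
        -- intros. apply scont_coord. unfold D; lia.
        -- intros. apply scont_coord. unfold D; lia.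
      * apply sclosed_eq; [apply scont_coord; unfold D; lia | apply scont_const].
      * apply sclosed_le; [apply scont_const |]. apply scont_mult; [apply scont_const |].
        apply scont_abs, scont_coord. unfold D; lia.
      * apply sclosed_forall. intros mu. apply sclosed_le; [apply scont_const |].
        apply scont_mult; [apply scont_const |]. apply scont_rsum. intros l Hl.
        apply scont_abs, scont_rsum. intros i Hi.
        apply scont_mult; [apply HscA; [assumption | now apply Hc] | apply scont_const].
    + intros w w' (Hkkt & Hx0 & Hnu0 & Hns) (Hkkt' & Hx0' & _ & _) Heq.
      assert (HA : forall i j, (i < m)%nat -> (j < N)%nat -> (i, j) <> (i0, j0) -> A w i j = A w' i j).
      { intros i j Hi Hj Hne. pose proof (flat_lt m N i j Hi Hj). apply Heq; [lia |].
        intros H'. apply flat_inj in H'; [| assumption | assumption]. destruct H'; congruence. }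
      assert (Hx : forall j, (j < N)%nat -> x w j = x w' j).
      (* After erasure both systems have the same matrix and the same right-hand side, so uniqueness
         for one matrix applies. *)
      { apply kkt_erase_column with (j0 := j0) in Hkkt; [| assumption].
        apply kkt_erase_column with (j0 := j0) in Hkkt'; [| assumption].
        apply (kkt_ext _ _ _ _ (fun i j => if (j =? j0)%nat then 0 else A w i j)
          _ (y w') _ (x w') _ (nu w')) in Hkkt'; try reflexivity.
        - apply (kkt_unique _ _ _ _ _ _ _ _ _ _ Hp Hkkt Hkkt').
          apply rsum_zero. intros i Hi.
          assert (Hy : y w i = y w' i); [| rewrite Hy; ring].
          apply rsum_ext. intros l Hl. destruct (Hsg l Hl) as [Hl1 Hl2].
          rewrite HA, (Heq (m * N + l)%nat) by (try assumption; try lia; congruence).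
          reflexivity.
        - intros i j Hi Hj. destruct (Nat.eqb_spec j j0); [reflexivity |].
          symmetry. apply HA; [assumption | assumption | congruence]. }
      destruct Hkkt as [Hst _]. destruct Hkkt' as [Hst' _].
      assert (Hnu : forall i, (i < m)%nat -> nu w i = nu w' i).
      { intros i Hi. apply Rminus_diag_uniq. apply Rabs_zero_inv.
        apply (rsum_zero_inv (fun i => Rabs (nu w i - nu w' i)) m); [intros; apply Rabs_pos | | assumption].
        eapply Rle_trans; [apply Hns |]. rewrite rsum_zero; [lra |].
        intros l Hl. destruct (Hc l Hl) as [Hl1 Hl2].
        rewrite (rsum_ext _ (fun i => A w i (c l) * nu w i - A w' i (c l) * nu w' i)).
        - rewrite rsum_minus, <- Hst, <- Hst', Hx by assumption. rewrite Rminus_diag. apply Rabs_R0.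
        - intros i' Hi'. rewrite (HA i' (c l)) by (try assumption; congruence). ring. }
      specialize (Hst j0 Hj0). specialize (Hst' j0 Hj0).
      rewrite Hx0, spow_0 in Hst. rewrite Hx0', spow_0 in Hst'.
      assert (H0 : (A w i0 j0 - A w' i0 j0) * nu w i0 = 0).
      { rewrite <- (rsum_single (fun i => (A w i j0 - A w' i j0) * nu w i) m i0 Hi0).
        - rewrite (rsum_ext _ (fun i => A w i j0 * nu w i - A w' i j0 * nu w' i)).
          + rewrite rsum_minus, <- Hst, <- Hst'. ring.
          + intros i Hi. rewrite <- Hnu by assumption. ring.
        - intros i Hi Hne. rewrite (HA i j0) by (try assumption; congruence). ring. }
      apply Rmult_integral in H0. destruct H0 as [H0 | H0].
      * apply Rminus_diag_uniq. exact H0.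
      * rewrite H0, Rabs_R0 in Hnu0. lra.
Qed.

(** * Bases of column ranges *)

Lemma column_basis m (A : nat -> nat -> R) (L : list nat) :
  exists s : list nat, incl s L /\
    independent m (length s) (fun i l => A i (nth l s O)) /\
    forall j, In j L -> exists z, forall i, (i < m)%nat ->
      A i j = mv (fun i l => A i (nth l s O)) (length s) z i.
Proof.
  induction L as [| j0 L (s & Hs & Hind & Hspan)].
  - exists nil. split; [apply incl_refl | split; [intros z _ l Hl; simpl in Hl; lia | intros j []]].
  - destruct (classic (exists z, forall i, (i < m)%nat ->
      A i j0 = mv (fun i l => A i (nth l s O)) (length s) z i)) as [H0 | H0].
    + exists s. split; [now apply incl_tl | split; [assumption |]].
      intros j [<- | Hj]; auto.
    + exists (s ++ [j0]).
      assert (Hmv : forall z i, mv (fun i l => A i (nth l (s ++ [j0]) O)) (length (s ++ [j0])) z i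
        = mv (fun i l => A i (nth l s O)) (length s) z i + A i j0 * z (length s)).
      { intros z i. unfold mv. rewrite length_app, Nat.add_comm. simpl Nat.add.
        rewrite rsum_S, nth_middle. f_equal. apply rsum_ext. intros l Hl. now rewrite app_nth1. }
      split; [| split].
      * apply incl_app; [now apply incl_tl |]. intros j [<- | []]. now left.
      * intros z Hz.
        assert (Hz0 : z (length s) = 0).
        { apply NNPP. intros Hne. apply H0. exists (fun l => - / z (length s) * z l).
          intros i Hi. specialize (Hz i Hi). rewrite Hmv in Hz. unfold mv in *.
          rewrite (rsum_ext _ (fun l => - / z (length s) * (A i (nth l s O) * z l))) by (intros; ring).
          rewrite rsum_scal. apply Rmult_eq_reg_r with (z (length s)); [| assumption].
          replace (- / z (length s) * rsum (fun j => A i (nth j s O) * z j) (length s) * z (length s))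
            with (- rsum (fun j => A i (nth j s O) * z j) (length s)) by (field; assumption).
          lra. }
        intros l Hl. rewrite length_app in Hl. simpl in Hl.
        destruct (Nat.eq_dec l (length s)) as [-> | Hne]; [assumption |].
        apply Hind; [| lia]. intros i Hi. specialize (Hz i Hi). rewrite Hmv, Hz0 in Hz. lra.
      * intros j [<- | Hj].
        -- exists (fun l => if (l =? length s)%nat then 1 else 0). intros i Hi.
           rewrite Hmv, Nat.eqb_refl. unfold mv. rewrite rsum_zero; [ring |].
           intros l Hl. destruct (Nat.eqb_spec l (length s)); [lia | ring].
        -- destruct (Hspan j Hj) as [z Hz].
           exists (fun l => if (l =? length s)%nat then 0 else z l). intros i Hi.
           rewrite Hmv, Nat.eqb_refl, Hz, Rmult_0_r, Rplus_0_r by assumption.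
           apply rsum_ext. intros l Hl. destruct (Nat.eqb_spec l (length s)); [lia | reflexivity].
Qed.

Lemma colrange_basis m N A (P : nat -> Prop) L s :
  (forall j, In j L <-> (j < N)%nat /\ P j) -> incl s L ->
  (forall j, In j L -> exists z, forall i, (i < m)%nat ->
      A i j = mv (fun i l => A i (nth l s O)) (length s) z i) ->
  forall y, colrange m N A P y <->
    exists z, forall i, (i < m)%nat -> y i = mv (fun i l => A i (nth l s O)) (length s) z i.
Proof.
  intros HL Hs Hspan y. split.
  - intros (x & Hx & Hy).
    assert (Hc : forall j, exists z : nat -> R, In j L -> forall i, (i < m)%nat ->
      A i j = mv (fun i l => A i (nth l s O)) (length s) z i).
    { intros j. destruct (classic (In j L)) as [Hj | Hj].
      - destruct (Hspan j Hj) as [z Hz]. now exists z.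
      - exists (fun _ => 0). contradiction. }
    apply functional_choice in Hc. destruct Hc as [Z HZ].
    exists (fun l => rsum (fun j => x j * Z j l) N). intros i Hi. rewrite Hy by assumption.
    unfold mv. rewrite (rsum_ext _ (fun j => rsum (fun l => A i (nth l s O) * (x j * Z j l)) (length s))).
    + rewrite rsum_swap. apply rsum_ext. intros l _. now rewrite rsum_scal.
    + intros j Hj. destruct (classic (P j)) as [HP | HP].
      * rewrite (HZ j) by (try assumption; apply HL; auto). unfold mv.
        rewrite Rmult_comm, <- rsum_scal. apply rsum_ext. intros. ring.
      * rewrite Hx by assumption. rewrite rsum_zero; [ring |]. intros. ring.
  (* Adding up all positions of [j] in [s] makes the formula valid even for a list with
     repetitions. *)
  - intros [z Hz]. exists (fun j => rsum (fun l => if (nth l s O =? j)%nat then z l else 0) (length s)).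
    assert (Hin : forall l, (l < length s)%nat -> In (nth l s O) L) by (intros; now apply Hs, nth_In).
    split.
    + intros j Hj HP. apply rsum_zero. intros l Hl.
      destruct (Nat.eqb_spec (nth l s O) j) as [<- |]; [| reflexivity].
      destruct HP. now apply HL, Hin.
    + intros i Hi. rewrite Hz by assumption. unfold mv.
      rewrite (rsum_ext (fun j => A i j * _)
        (fun j => rsum (fun l => A i j * (if (nth l s O =? j)%nat then z l else 0)) (length s)))
        by (intros; now rewrite rsum_scal).
      rewrite rsum_swap. apply rsum_ext. intros l Hl.
      rewrite (rsum_single _ N (nth l s O)).
      * now rewrite Nat.eqb_refl.
      * now apply HL, Hin.
      * intros j _ Hne. destruct (Nat.eqb_spec (nth l s O) j); [congruence | ring].
Qed.

Lemma list_of_pred (P : nat -> Prop) N : exists L, forall j, In j L <-> (j < N)%nat /\ P j.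
Proof.
  induction N as [| N [L HL]].
  - exists nil. intros j. split; [intros [] | intros [H _]; lia].
  - destruct (classic (P N)) as [HP | HP].
    + exists (N :: L). intros j. simpl. rewrite HL. split.
      * intros [<- | [H1 H2]]; auto with arith.
      * intros [H1 H2]. destruct (Nat.eq_dec N j); [now left | right; split; [lia | assumption]].
    + exists L. intros j. rewrite HL. split; intros [H1 H2]; split; auto.
      destruct (Nat.eq_dec N j); [subst; contradiction | lia].
Qed.

(** The increasing enumeration of the indices other than [j]. Its first [m] values are at most [m],
    so they are column indices when [m < N]. *)
Definition skip (j l : nat) : nat := if (l <? j)%nat then l else S l.

Lemma skip_spec j l : skip j l <> j /\ (skip j l <= S l)%nat.
Proof. unfold skip. destruct (Nat.ltb_spec l j); lia. Qed.

Lemma skip_inj j l l' : skip j l = skip j l' -> l = l'.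
Proof. unfold skip. destruct (Nat.ltb_spec l j), (Nat.ltb_spec l' j); lia. Qed.

Theorem theorem5p1 (p : R) (m N : nat) (I : nat -> Prop)
  (hp : 1 < p) (hm : (1 <= m)%nat) (hN : (2 * m - 1 <= N)%nat)
  (hI : forall j, I j -> (j < N)%nat) (hIne : exists j, I j) :
  exists SA : (nat -> nat -> R) -> Prop,
    matnull m N (fun A => ~ SA A) /\
    forall A, SA A ->
      ae_subspace m (colrange m N A I)
        (fun y => exists x,
           lp_opt p m N A y x /\
           (forall x', lp_opt p m N A y x' ->
                       forall j, (j < N)%nat -> x' j = x j) /\
           (forall j, (j < N)%nat -> x j <> 0)).
Proof.
  destruct hIne as [j0 Hj0]. pose proof (hI j0 Hj0) as Hj0N.
  (* [s] is any index list here, not a basis attached to a matrix, because [SA] is fixed before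
     [A]. *)
  set (unused := fun (s : list nat) j i =>
    (m < N)%nat /\ (0 < length s)%nat /\ (i < m)%nat /\ (j < N)%nat /\
    forall l, (l < length s)%nat -> (nth l s O < N)%nat /\ nth l s O <> j).
  set (bad := fun A (s : list nat) j i z => exists x nu,
    kkt p m N A (mv (fun i l => A i (nth l s O)) (length s) z) x nu /\ x j = 0 /\ nu i <> 0).
  set (SA := fun A =>
    nonsingular 1 A (fun _ => j0) /\ nonsingular m A (fun l => l) /\
    (forall j, (j < N)%nat -> (m < N)%nat -> nonsingular m A (skip j)) /\
    (forall s j i, unused s j i -> nullset (length s) (bad A s j i))).
  exists SA. split.
  - apply nullset_subset with (fun v => let A := fun i j => v (i * N + j)%nat in
      (~ nonsingular 1 A (fun _ => j0) \/ ~ nonsingular m A (fun l => l)) \/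
      (exists j, ((j < N)%nat /\ (m < N)%nat) /\ ~ nonsingular m A (skip j)) \/
      (exists s j i, unused s j i /\ nonsingular m A (skip j) /\
         ~ nullset (length s) (bad A s j i))).
    + intros v Hv A. change (~ SA A) in Hv. apply NNPP. intros Hno. apply Hv.
      assert (H3 : forall j, (j < N)%nat -> (m < N)%nat -> nonsingular m A (skip j)).
      { intros j Hj HmN. apply NNPP. intros H. apply Hno. right. left. now exists j. }
      split; [| split; [| split; [assumption |]]].
      * apply NNPP. intros H. apply Hno. left. now left.
      * apply NNPP. intros H. apply Hno. left. now right.
      * intros s j i Hu. apply NNPP. intros H. apply Hno. right. right.
        exists s, j, i. split; [assumption | split; [| assumption]].
        apply H3; apply Hu.
    + apply nullset_or; [apply nullset_or | apply nullset_or].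
      * apply (nonsingular_ae m N 1 (fun _ => j0)); intros; lia.
      * apply (nonsingular_ae m N m (fun l => l)); intros; lia.
      * apply nullset_union. intros j.
        destruct (classic ((j < N)%nat /\ (m < N)%nat)) as [Hj | Hj].
        -- apply nullset_subset with (fun v => ~ nonsingular m (fun i j => v (i * N + j)%nat) (skip j));
             [intros v Hv; apply Hv |].
           apply (nonsingular_ae m N m (skip j)); try lia.
           ++ intros l Hl. pose proof (skip_spec j l). lia.
           ++ intros l l' _ _. apply skip_inj.
        -- apply nullset_empty; [nia |]. intros v [H _]. contradiction.
      * apply nullset_union_list. intros s. apply nullset_union. intros j. apply nullset_union. intros i.
        destruct (classic (unused s j i)) as [Hu | Hu].
        -- apply nullset_subset with (fun v => let A := fun i j => v (i * N + j)%nat in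
             nonsingular m A (skip j) /\ ~ nullset (length s) (bad A s j i));
             [intros v Hv; apply Hv |].
           destruct Hu as (HmN & Hs & Hi & Hj & Hsj).
           apply (zero_at_unused_column_null p m N (length s) (fun l => nth l s O) (skip j) i j); auto.
           intros l Hl. pose proof (skip_spec j l). lia.
        -- apply nullset_empty; [nia |]. intros v [H _]. contradiction.
  - intros A (H1 & H2 & H3 & H4).
    destruct (list_of_pred I N) as [L HL].
    destruct (column_basis m A L) as (s & Hs & Hind & Hspan).
    set (B := fun i l => A i (nth l s O)).
    assert (HsN : forall l, (l < length s)%nat -> (nth l s O < N)%nat)
      by (intros l Hl; apply HL, Hs, nth_In; assumption).
    (* The entry [A 0 j0] is nonzero by the first clause of [SA], so column [j0] is not in the span
       of the empty list. Positive dimension of the parameter space is required by [nullset]. *)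
    assert (Hlen : (0 < length s)%nat).
    { destruct (length s) eqn:E; [| lia]. exfalso.
      destruct (Hspan j0) as [z Hz]; [now apply HL |].
      specialize (Hz O ltac:(lia)). unfold mv, rsum in Hz. simpl in Hz.
      apply R1_neq_R0. apply (H1 (fun _ => 1)) with O; [| lia].
      intros l _. unfold rsum. simpl. rewrite Hz. lra. }
    exists (length s), B. split; [exact Hind | split; [now apply colrange_basis with L |]].
    apply nullset_subset with (fun z =>
      (exists l, (l < length s)%nat /\ exists x nu, kkt p m N A (mv B (length s) z) x nu /\ x (nth l s O) = 0) \/
      (exists j i, unused s j i /\ bad A s j i z)).
    + intros z Hz.
      destruct (kkt_exists p m N A (mv B (length s) z) (fun l => l) hp H2) as (x & nu & Hk);
        [intros; lia | auto |].
      destruct (kkt_optimal _ _ _ _ _ _ _ hp Hk) as [Hopt Huniq].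
      assert (Hzero : exists j, (j < N)%nat /\ x j = 0).
      { apply NNPP. intros Hno. apply Hz. exists x. split; [assumption | split; [assumption |]].
        intros j Hj H0. apply Hno. now exists j. }
      destruct Hzero as (j & Hj & Hx0).
      destruct (classic (exists l, (l < length s)%nat /\ nth l s O = j)) as [(l & Hl & <-) | Hns].
      { left. exists l. split; [assumption |]. now exists x, nu. }
      destruct (classic (exists i, (i < m)%nat /\ nu i <> 0)) as [(i & Hi & Hnu) | Hnu].
      * right. exists j, i. split; [| now exists x, nu].
        assert (Hsj : forall l, (l < length s)%nat -> (nth l s O < N)%nat /\ nth l s O <> j).
        { intros l Hl. split; [auto |]. intros H. apply Hns. now exists l. }
        (* The index [j] and the first basis index are distinct and below [N], so [N >= 2]; together
           with [2 * m - 1 <= N] this gives [m < N]. *)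
        destruct (Hsj O Hlen). repeat split; auto; try lia; now apply Hsj.
      (* A zero multiplier forces [x = 0], so the coordinate of the first basis column vanishes as
         well. *)
      * left. exists O. split; [assumption |]. exists x, nu. split; [assumption |].
        rewrite <- (spow_inv (p - 1) (x (nth O s O))) by lra.
        rewrite (proj1 Hk) by auto. rewrite rsum_zero; [apply spow_0 |].
        intros i Hi. assert (H0 : nu i = 0) by (apply NNPP; intros Hne; apply Hnu; now exists i).
        rewrite H0. ring.
    + apply nullset_or; apply nullset_union.
      * intros l. destruct (Nat.lt_ge_cases l (length s)) as [Hl | Hl].
        -- apply nullset_subset with (fun z => exists x nu,
             kkt p m N A (mv B (length s) z) x nu /\ x (nth l s O) = 0); [intros z Hz; apply Hz |].
           apply (zero_at_used_column_null p m N A (length s) (fun l => nth l s O) l); auto.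
        -- apply nullset_empty; [assumption |]. intros z [H _]. lia.
      * intros j. apply nullset_union. intros i.
        destruct (classic (unused s j i)) as [Hu | Hu].
        -- apply nullset_subset with (bad A s j i); [intros z Hz; apply Hz |]. now apply H4.
        -- apply nullset_empty; [assumption |]. intros z [H _]. contradiction.
Qed.
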